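(* Let $d\geq 1$, let $A$ be a basic finite-dimensional algebra over a field and let $\mathcal{M}\subseteq\operatorname{mod}A$ be a $d$-cluster tilting subcategory. Let $P$ be a simple projective $A$-module which is not injective, write $A=P\oplus Q$, and let $T_1^P=\tau^-P\oplus Q$ be the associated APR tilting module and $T_d^P=\tau_d^-P\oplus Q$ the associated weak $d$-APR tilting module. Then $T_d^P$ is the basic $\operatorname{Ext}^d$-projective generator of the $d$-torsion class $\mathcal{U}=\operatorname{Fac}T_1^P\cap\mathcal{M}$ in $\mathcal{M}$. In particular, the module $T_d^P$ is $d$-tilting.
   Context: $\operatorname{mod}A$ is the category of finitely generated right $A$-modules. All subcategories are full and closed under isomorphisms, finite direct sums and direct summands. $\operatorname{Fac}T$ is the class of quotients of finite direct sums of copies of $T$. A functorially finite subcategory $\mathcal{M}\subseteq\operatorname{mod}A$ is $d$-cluster tilting if $\mathcal{M}=\{X\mid \operatorname{Ext}^i_A(X,M)=0\ \forall M\in\mathcal{M},\,1\le i\le d-1\}=\{Y\mid \operatorname{Ext}^i_A(M,Y)=0\ \forall M\in\mathcal{M},\,1\le i\le d-1\}$. $\tau_d^-M=\operatorname{Coker}\nu^-(g)$ where $0\to M\to I_0\to\cdots\to I_{d-1}\xrightarrow{g}I_d\to\cdots$ is a minimal injective coresolution and $\nu^-=\operatorname{Hom}_A(DA,-)$; $\tau^-=\tau_1^-$. A subcategory $\mathcal{U}\subseteq\mathcal{M}$ is a $d$-torsion class if for every $M\in\mathcal{M}$ there is an exact sequence $0\to U_M\to M\to V_1\to\cdots\to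 V_d\to 0$ in $\operatorname{mod}A$ with all terms in $\mathcal{M}$, such that $U_M\in\mathcal{U}$ and $0\to\operatorname{Hom}_A(U,V_1)\to\cdots\to\operatorname{Hom}_A(U,V_d)\to 0$ is exact for every $U\in\mathcal{U}$. (The subcategory $\operatorname{Fac}T_1^P\cap\mathcal{M}$ is a functorially finite $d$-torsion class.) $X\in\mathcal{U}$ is $\operatorname{Ext}^d$-projective in $\mathcal{U}$ if $\operatorname{Ext}^d_A(X,U)=0$ for all $U\in\mathcal{U}$; it is an $\operatorname{Ext}^d$-projective generator of $\mathcal{U}$ if moreover every $\operatorname{Ext}^d$-projective object of $\mathcal{U}$ lies in $\operatorname{add}(X)$. An $A$-module $T$ is $d$-tilting if $\operatorname{pd}_AT\le d$, $\operatorname{Ext}^i_A(T,T)=0$ for all $i>0$, and there is an exact sequence $0\to A\to T_0\to\cdots\to T_d\to 0$ with all $T_i\in\operatorname{add}(T)$. *)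

(* Defs.v *)
From HB Require Import structures.
From mathcomp Require Import all_boot all_algebra all_field.
From mathcomp Require Import boolp.

Set Implicit Arguments.
Unset Strict Implicit.
Unset Printing Implicit Defensive.

Import GRing.Theory.
Local Open Scope ring_scope.

(** ** Finitely generated modules *)

Definition finitely_generated (R : nzRingType) (M : lmodType R) : Prop :=
  exists s : seq M, forall x : M,
    exists c : 'I_(size s) -> R, x = \sum_(i < size s) c i *: s`_i.

(* Objects of the category of finitely generated left R-modules. Finitely
   generated right A-modules are the objects of fgmod A^c, where A^c is the
   opposite ring; morphisms are the {linear X -> Y}. *)
Record fgmod (R : nzRingType) := FgMod {
  fgmod_car :> lmodType R;
  fgmod_fg : finitely_generated fgmod_car }.

Section Construction.
Variable R : nzRingType.

Lemma fg_zero : finitely_generated ('rV[R]_0 : lmodType R).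
Proof.
by exists [::] => x; exists (fun=> 0); rewrite big_ord0; apply/rowP; case.
Qed.

Lemma fg_regular : finitely_generated (R^o : lmodType R).
Proof.
exists [:: 1] => x; exists (fun=> x).
by rewrite big_ord1 /= /GRing.scale /= mulr1.
Qed.

Lemma fg_prod (X Y : fgmod R) : finitely_generated (X * Y)%type.
Proof.
case: (fgmod_fg X) => s hs; case: (fgmod_fg Y) => t ht.
pose l : seq (X * Y) := [seq (x, 0) | x <- s] ++ [seq (0, y) | y <- t].
have sz : size l = (size s + size t)%N by rewrite size_cat !size_map.
exists l => -[x y]; have [c hc] := hs x; have [e he] := ht y.
pose g (i : 'I_(size s + size t)) : R :=
  match split i with inl j => c j | inr j => e j end.
exists (fun i => g (cast_ord sz i)).
rewrite (reindex (cast_ord (esym sz))) /=; last first.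
  by apply: onW_bij; exists (cast_ord sz); [exact: cast_ordKV | exact: cast_ordK].
under eq_bigr do rewrite cast_ordKV.
rewrite big_split_ord /=.
have -> : \sum_(i < size s) g (lshift (size t) i) *: l`_i = (x, 0).
  rewrite [in RHS]hc; transitivity (\sum_(i < size s) (c i *: s`_i, 0 : Y)).
    apply: eq_bigr => i _; rewrite /g (unsplitK (inl _ i)).
    rewrite nth_cat size_map ltn_ord (nth_map 0) //.
    by congr pair; rewrite /= scaler0.
  by elim/big_rec2: _ => // i a b _ ->; congr pair; rewrite /= addr0.
have -> : \sum_(i < size t) g (rshift (size s) i) *: l`_(size s + i) = (0, y).
  rewrite [in RHS]he; transitivity (\sum_(i < size t) (0 : X, e i *: t`_i)).
    apply: eq_bigr => i _; rewrite /g (unsplitK (inr _ i)).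
    rewrite nth_cat size_map ltnNge leq_addr /= addKn (nth_map 0) //.
    by congr pair; rewrite /= scaler0.
  by elim/big_rec2: _ => // i a b _ ->; congr pair; rewrite /= addr0.
by congr pair; rewrite /= ?addr0 ?add0r.
Qed.

End Construction.

Definition zero_mod (R : nzRingType) : fgmod R := FgMod (fg_zero R).
Definition regular_mod (R : nzRingType) : fgmod R := FgMod (fg_regular R).
Definition dsum (R : nzRingType) (X Y : fgmod R) : fgmod R :=
  FgMod (fg_prod X Y).
Definition dsums (R : nzRingType) (s : seq (fgmod R)) : fgmod R :=
  foldr (@dsum R) (zero_mod R) s.

(** ** Module-theoretic notions *)

Definition surjective (X Y : Type) (f : X -> Y) : Prop :=
  forall y, exists x, f x = y.

Definition exact_at (R : nzRingType) (X Y Z : lmodType R)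
    (f : {linear X -> Y}) (g : {linear Y -> Z}) : Prop :=
  forall y, g y = 0 <-> exists x, f x = y.

Definition is_zero (R : nzRingType) (X : fgmod R) : Prop :=
  forall x : X, x = 0.

Definition iso (R : nzRingType) (X Y : fgmod R) : Prop :=
  exists f : {linear X -> Y}, bijective f.

Definition simple_mod (R : nzRingType) (X : fgmod R) : Prop :=
  ~ is_zero X /\
  forall (Y : fgmod R) (j : {linear Y -> X}),
    injective j -> is_zero Y \/ surjective j.

Definition indecomposable (R : nzRingType) (X : fgmod R) : Prop :=
  ~ is_zero X /\
  forall Y Z : fgmod R, iso X (dsum Y Z) -> is_zero Y \/ is_zero Z.

Definition basic (R : nzRingType) (X : fgmod R) : Prop :=
  exists (n : nat) (F : 'I_n -> fgmod R),
    [/\ iso X (dsums [seq F i | i <- enum 'I_n]),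
        forall i, indecomposable (F i)
      & forall i j, iso (F i) (F j) -> i = j].

Definition projective (R : nzRingType) (P : fgmod R) : Prop :=
  forall (Y Z : fgmod R) (p : {linear Y -> Z}) (f : {linear P -> Z}),
    surjective p -> exists g : {linear P -> Y}, forall x, p (g x) = f x.

Definition injective_mod (R : nzRingType) (I : fgmod R) : Prop :=
  forall (Y Z : fgmod R) (j : {linear Y -> Z}) (f : {linear Y -> I}),
    injective j -> exists g : {linear Z -> I}, forall y, g (j y) = f y.

(* The image of f is an essential submodule of its target. *)
Definition essential_image (R : nzRingType) (X I : fgmod R)
    (f : {linear X -> I}) : Prop :=
  forall (Y : fgmod R) (j : {linear Y -> I}), injective j ->
    (forall x y, f x = j y -> j y = 0) -> is_zero Y.

Definition add_of (R : nzRingType) (T X : fgmod R) : Prop :=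
  exists (n : nat) (Y : fgmod R), iso (dsum X Y) (dsums (nseq n T)).

Definition Fac (R : nzRingType) (T X : fgmod R) : Prop :=
  exists (n : nat) (p : {linear dsums (nseq n T) -> X}), surjective p.

(** ** Resolutions and vanishing of Ext *)

(* Resolutions are indexed by nat; a finite one is padded with zero modules. *)

Definition resolution (R : nzRingType) (X : fgmod R) (P : nat -> fgmod R)
    (e : {linear P 0%N -> X}) (f : forall i, {linear P i.+1 -> P i}) : Prop :=
  [/\ surjective e, exact_at (f 0%N) e
    & forall i, exact_at (f i.+1) (f i)].

Definition coresolution (R : nzRingType) (X : fgmod R) (I : nat -> fgmod R)
    (e : {linear X -> I 0%N}) (f : forall i, {linear I i -> I i.+1}) : Prop :=
  [/\ injective e, exact_at e (f 0%N)
    & forall i, exact_at (f i) (f i.+1)].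

Definition min_injective_coresolution (R : nzRingType) (X : fgmod R)
    (I : nat -> fgmod R) (e : {linear X -> I 0%N})
    (f : forall i, {linear I i -> I i.+1}) : Prop :=
  [/\ coresolution e f, forall i, injective_mod (I i), essential_image e
    & forall i, essential_image (f i)].

Definition pd_le (R : nzRingType) (d : nat) (X : fgmod R) : Prop :=
  exists (P : nat -> fgmod R) (e : {linear P 0%N -> X})
         (f : forall i, {linear P i.+1 -> P i}),
    [/\ resolution e f, forall i, projective (P i)
      & forall i, (d < i)%N -> is_zero (P i)].

(* The complex Hom(P_0,Y) -> Hom(P_1,Y) -> ... has zero cohomology in degree
   i. *)
Definition hom_complex_exact (R : nzRingType) (P : nat -> fgmod R)
    (f : forall i, {linear P i.+1 -> P i}) (Y : fgmod R) (i : nat) : Prop :=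
  match i with
  | 0%N => forall h : {linear P 0%N -> Y},
      (forall x, h (f 0%N x) = 0) -> forall x, h x = 0
  | j.+1 => forall h : {linear P j.+1 -> Y},
      (forall x, h (f j.+1 x) = 0) ->
      exists g : {linear P j -> Y}, forall x, h x = g (f j x)
  end.

(* Ext^i(X,Y) = 0; this does not depend on the projective resolution of X, and
   one by finitely generated projectives exists when R is Noetherian. *)
Definition ext_zero (R : nzRingType) (i : nat) (X Y : fgmod R) : Prop :=
  exists (P : nat -> fgmod R) (e : {linear P 0%N -> X})
         (f : forall i, {linear P i.+1 -> P i}),
    [/\ resolution e f, forall i, projective (P i)
      & hom_complex_exact f Y i].

(** ** Subcategories, d-cluster tilting and d-torsion classes *)

(* Full subcategories are given by their class of objects. *)
Definition subcategory (R : nzRingType) (U : fgmod R -> Prop) : Prop :=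
  [/\ forall X Y, iso X Y -> U X -> U Y,
      U (zero_mod R),
      forall X Y, U X -> U Y -> U (dsum X Y)
    & forall X Y, U (dsum X Y) -> U X /\ U Y].

Definition functorially_finite (R : nzRingType) (M : fgmod R -> Prop) : Prop :=
  forall X : fgmod R,
    (exists (N : fgmod R) (f : {linear N -> X}), M N /\
       forall (N' : fgmod R) (g : {linear N' -> X}), M N' ->
         exists h : {linear N' -> N}, forall x, g x = f (h x)) /\
    (exists (N : fgmod R) (f : {linear X -> N}), M N /\
       forall (N' : fgmod R) (g : {linear X -> N'}), M N' ->
         exists h : {linear N -> N'}, forall x, g x = h (f x)).

Definition cluster_tilting (R : nzRingType) (d : nat) (M : fgmod R -> Prop) :
    Prop :=
  [/\ subcategory M,
      functorially_finite M,
      forall X, M X <->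
        forall N, M N -> forall i, (0 < i < d)%N -> ext_zero i X N
    & forall Y, M Y <->
        forall N, M N -> forall i, (0 < i < d)%N -> ext_zero i N Y].

(* The exact sequence is 0 -> UX -> X -> V_1 -> ... -> V_d -> 0, with V_i
   written V (i - 1) and V padded with zero modules. *)
Definition torsion_class (R : nzRingType) (d : nat) (M U : fgmod R -> Prop) :
    Prop :=
  [/\ subcategory U,
      forall X, U X -> M X
    & forall X, M X ->
      exists (UX : fgmod R) (V : nat -> fgmod R) (u : {linear UX -> X})
             (p : {linear X -> V 0%N}) (v : forall i, {linear V i -> V i.+1}),
      [/\ U UX,
          forall i, (i < d)%N -> M (V i),
          forall i, (d <= i)%N -> is_zero (V i),
          [/\ injective u, exact_at u p, exact_at p (v 0%N)
            & forall i, exact_at (v i) (v i.+1)]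
        & forall W, U W ->
          (forall h : {linear W -> V 0%N},
             (forall w, v 0%N (h w) = 0) -> forall w, h w = 0) /\
          (forall i (h : {linear W -> V i.+1}),
             (forall w, v i.+1 (h w) = 0) ->
             exists g : {linear W -> V i}, forall w, h w = v i (g w))]].

Definition ext_projective (R : nzRingType) (d : nat) (U : fgmod R -> Prop)
    (X : fgmod R) : Prop :=
  U X /\ forall Y, U Y -> ext_zero d X Y.

Definition ext_projective_generator (R : nzRingType) (d : nat)
    (U : fgmod R -> Prop) (X : fgmod R) : Prop :=
  ext_projective d U X /\ forall Y, ext_projective d U Y -> add_of X Y.

Definition tilting (R : nzRingType) (d : nat) (T : fgmod R) : Prop :=
  [/\ pd_le d T,
      forall i, (0 < i)%N -> ext_zero i T T
    & exists (S : nat -> fgmod R) (e : {linear regular_mod R -> S 0%N})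
             (f : forall i, {linear S i -> S i.+1}),
        [/\ coresolution e f, forall i, (i <= d)%N -> add_of T (S i)
          & forall i, (d < i)%N -> is_zero (S i)]].

(** ** The bimodule DA = Hom_k(A, k) and the functor Hom_A(DA, -) *)

Definition dual (k : fieldType) (A : falgType k) : Type := 'Hom(A, k^o).

Section Dual.
Variables (k : fieldType) (A : falgType k).

HB.instance Definition _ := GRing.Zmodule.on (dual A).

(* The right action (f . a)(x) = f (a x). *)
Definition dual_ract (a : A^c) (f : dual A) : dual A :=
  ((f : 'Hom(A, k^o)) \o amull (a : A))%VF.

(* The left action (a . f)(x) = f (x a). *)
Definition dual_lact (a : A) (f : dual A) : dual A :=
  ((f : 'Hom(A, k^o)) \o amulr a)%VF.

Lemma dual_ractE (a : A) (f : 'Hom(A, k^o)) x :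
  (dual_ract a f : 'Hom(A, k^o)) x = f (a * x).
Proof. by rewrite /dual_ract lfunE /= lfunE. Qed.

Lemma dual_lactE a (f : 'Hom(A, k^o)) x :
  (dual_lact a f : 'Hom(A, k^o)) x = f (x * a).
Proof. by rewrite /dual_lact lfunE /= lfunE. Qed.

Fact dual_ractA a b f : dual_ract a (dual_ract b f) = dual_ract (a * b) f.
Proof. by apply/lfunP => x; rewrite !dual_ractE mulrA. Qed.

Fact dual_ract1 : left_id 1 dual_ract.
Proof. by move=> f; apply/lfunP => x; rewrite dual_ractE mul1r. Qed.

Fact dual_ractDr : right_distributive dual_ract +%R.
Proof.
move=> a f g; apply/lfunP => x.
by rewrite dual_ractE !add_lfunE !dual_ractE.
Qed.

Fact dual_ractDl f : {morph dual_ract^~ f : a b / a + b}.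
Proof.
move=> a b; apply/lfunP => x.
by rewrite dual_ractE add_lfunE !dual_ractE mulrDl linearD.
Qed.

HB.instance Definition _ := GRing.Zmodule_isLmodule.Build A^c (dual A)
  dual_ractA dual_ract1 dual_ractDr dual_ractDl.

Fact dual_lact_linear a : linear (dual_lact a : dual A -> dual A).
Proof.
move=> b f g; apply/lfunP => x; rewrite dual_lactE !add_lfunE dual_lactE.
by congr (_ + _); rewrite !dual_ractE dual_lactE mulrA.
Qed.

HB.instance Definition _ (a : A) :=
  GRing.isSemilinear.Build A^c (dual A) (dual A) _ (dual_lact a)
    (GRing.semilinear_linear (dual_lact_linear a)).

Lemma dual_lactM a b f : dual_lact (a * b) f = dual_lact a (dual_lact b f).
Proof. by apply/lfunP => x; rewrite !dual_lactE mulrA. Qed.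

Lemma dual_lact1 f : dual_lact 1 f = f.
Proof. by apply/lfunP => x; rewrite dual_lactE mulr1. Qed.

Lemma dual_lactD a b f : dual_lact (a + b) f = dual_lact a f + dual_lact b f.
Proof.
apply/lfunP => x.
by rewrite dual_lactE add_lfunE !dual_lactE mulrDr linearD.
Qed.

End Dual.

Lemma linear_ext (R : nzRingType) (X Y : lmodType R) (f g : {linear X -> Y}) :
  f =1 g -> f = g.
Proof.
case: f g => [f cf] [g cg] /= /funext fg; subst g; congr GRing.Linear.Pack.
by case: cf cg => [[a] [b]] [[c] [d]]; congr GRing.Linear.Class;
  [congr GRing.isNmodMorphism.Axioms_ | congr GRing.isScalable.Axioms_];
  exact: Prop_irrelevance.
Qed.

Definition nu_inv (k : fieldType) (A : falgType k) (M : lmodType A^c) : Type :=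
  {linear dual A -> M}.

Section NuInv.
Variables (k : fieldType) (A : falgType k).

Section Module.
Variable M : lmodType A^c.
Implicit Types p q : {linear dual A -> M}.

HB.instance Definition _ := gen_eqMixin (nu_inv M).
HB.instance Definition _ := gen_choiceMixin (nu_inv M).

Let zero : nu_inv M := (\0 : {linear dual A -> M}).
Let opp p : nu_inv M := (\- p : {linear dual A -> M}).
Let addm p q : nu_inv M := (p \+ q : {linear dual A -> M}).

Fact nu_inv_addA : associative (addm : nu_inv M -> nu_inv M -> nu_inv M).
Proof. by move=> p q r; apply: linear_ext => x /=; rewrite addrA. Qed.

Fact nu_inv_addC : commutative (addm : nu_inv M -> nu_inv M -> nu_inv M).
Proof. by move=> p q; apply: linear_ext => x /=; rewrite addrC. Qed.

Fact nu_inv_add0 : left_id zero (addm : nu_inv M -> nu_inv M -> nu_inv M).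
Proof. by move=> p; apply: linear_ext => x /=; rewrite add0r. Qed.

Fact nu_inv_addN :
  left_inverse zero opp (addm : nu_inv M -> nu_inv M -> nu_inv M).
Proof. by move=> p; apply: linear_ext => x /=; rewrite addNr. Qed.

HB.instance Definition _ := GRing.isZmodule.Build (nu_inv M)
  nu_inv_addA nu_inv_addC nu_inv_add0 nu_inv_addN.

(* The right action (p . a)(f) = p (a . f). *)
Definition nu_inv_ract (a : A^c) (p : nu_inv M) : nu_inv M :=
  ((p : {linear dual A -> M}) \o dual_lact (a : A) : {linear dual A -> M}).

Fact nu_inv_ractA a b p :
  nu_inv_ract a (nu_inv_ract b p) = nu_inv_ract (a * b) p.
Proof. by apply: linear_ext => x /=; rewrite dual_lactM. Qed.

Fact nu_inv_ract1 : left_id 1 nu_inv_ract.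
Proof. by move=> p; apply: linear_ext => x /=; rewrite dual_lact1. Qed.

Fact nu_inv_ractDr : right_distributive nu_inv_ract +%R.
Proof. by move=> a p q; apply: linear_ext. Qed.

Fact nu_inv_ractDl p : {morph nu_inv_ract^~ p : a b / a + b}.
Proof.
by move=> a b; apply: linear_ext => x /=; rewrite dual_lactD linearD.
Qed.

HB.instance Definition _ := GRing.Zmodule_isLmodule.Build A^c (nu_inv M)
  nu_inv_ractA nu_inv_ract1 nu_inv_ractDr nu_inv_ractDl.

End Module.

Variables (M N : lmodType A^c) (g : {linear M -> N}).

Definition nu_inv_map (p : nu_inv M) : nu_inv N :=
  (g \o (p : {linear dual A -> M}) : {linear dual A -> N}).

Fact nu_inv_map_linear : linear nu_inv_map.
Proof. by move=> a p q; apply: linear_ext => x /=; rewrite linearD. Qed.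

HB.instance Definition _ :=
  GRing.isSemilinear.Build A^c (nu_inv M) (nu_inv N) _ nu_inv_map
    (GRing.semilinear_linear nu_inv_map_linear).

End NuInv.

(* X is isomorphic to tau_d^- M, for d >= 1: X is a cokernel of nu^-(g), where
   g : I_(d-1) -> I_d comes from a minimal injective coresolution of M. *)
Definition is_tau_inv (k : fieldType) (A : falgType k) (d : nat)
    (M X : fgmod A^c) : Prop :=
  exists (I : nat -> fgmod A^c) (e : {linear M -> I 0%N})
         (f : forall i, {linear I i -> I i.+1}),
    min_injective_coresolution e f /\
    exists p : {linear nu_inv (I d.-1.+1) -> X},
      surjective p /\ exact_at (nu_inv_map (f d.-1)) p.

(* Main.v *)
From HB Require Import structures.
Require Import Defs.
From mathcomp Require Import all_boot all_algebra all_field.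
From mathcomp Require Import boolp.

Set Implicit Arguments.
Unset Strict Implicit.
Unset Printing Implicit Defensive.

Import GRing.Theory.
Local Open Scope ring_scope.

(** Let 0 -> P -> I_0 -> I_1 -> ... be the minimal injective coresolution of
    P, let nu^- = Hom(DA, -) and E_j = nu^- I_j.

    Minimality and the simplicity of P give E_0 = P (nu_obj0_iso) and
    Hom(E_j, P) = 0 for j > 0 (no_hom_nu_obj), so E_j is in add Q for j > 0.
    Since P and DA lie in M, the groups Ext^i(DA, P) vanish for 0 < i < d, and
    Hom(DA, P) = 0 because P is not injective. Hence
      0 -> P -> E_1 -> ... -> E_d -> tau_d^- P -> 0
    is exact. It is at the same time a projective resolution of tau_d^- P of
    length d (tau_resolution) and, together with the identity of Q, the
    coresolution of A required of a tilting module (Td_coresolution).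

    Hom(E_j, X) is the k-dual of Hom(X, I_j), naturally in I_j; nu_hom_exact
    records the consequence that exactness of Hom(X, I) passes to Hom(E, X).
    So Ext^i(tau_d^- P, X) is dual to Ext^(d-i)(X, P) for 0 < i < d, which
    vanishes for X in M and puts tau_d^- P in M, and Ext^d(tau_d^- P, X) is
    dual to Hom(X, P). In degree 1 the same computation shows that every map
    P -> X extends along P -> E_1 when Hom(X, P) = 0. As tau^- P is a
    quotient of a module in add Q, it follows that Fac T_1 is exactly the
    class of modules X with Hom(X, P) = 0 (Fac_of_no_hom). As P is simple
    projective, every module is a direct sum of such an X and of copies of P
    (simple_decomposition). Therefore U consists of the objects of M without
    nonzero maps to P, the torsion sequence of an object of M can be taken
    split, and T_d is an Ext^d-projective object of U.

    It remains to see that an Ext^d-projective Y in U lies in add T_d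
    (Y_in_add). Choose a basis of Ext^d(Y, P) over the division ring End(P);
    it is induced by a map Y -> W to a sum W of copies of tau_d^- P
    (universal_cocycle, downward_lift), because Ext^i(Y, Q) = 0 for 0 < i <=
    d. Then Ext^d(W, N) -> Ext^d(Y, N) is bijective for all N in M. If L is
    the kernel of the surjection Y + E_d^m -> W, the mapping cone is a
    projective resolution of L and shows that Ext^i(L, M) = 0 for 0 < i <=
    d. Such an L is projective and in M (projective_criterion), and the
    inclusion of L splits, so Y is a summand of the sum of L and W.

    Finally T_d is basic: Q is the sum of the indecomposable summands of A
    other than P, and tau_d^- P is indecomposable because an idempotent
    endomorphism lifts to the resolution, whose top term P has a division
    ring of endomorphisms (tau_indecomposable). *)

(** * Linear maps, images and splittings *)

Section LinearMaps.
Variable R : nzRingType.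

Definition mklin (X Y : lmodType R) (f : X -> Y) (hf : linear f) :
    {linear X -> Y} :=
  HB.pack f
    (GRing.isSemilinear.Build R X Y *:%R f (GRing.semilinear_linear hf)).

Lemma factor_surj (X K Y : lmodType R) (s : {linear X -> K})
    (h : {linear X -> Y}) :
  surjective s -> (forall x, s x = 0 -> h x = 0) ->
  exists h' : {linear K -> Y}, forall x, h' (s x) = h x.
Proof.
move=> sS sh; pose t y := sval (cid (sS y)).
have st y : s (t y) = y by rewrite /t; case: cid.
have eqh x y : s x = s y -> h x = h y.
  move=> e; apply/eqP; rewrite -subr_eq0 -linearB; apply/eqP/sh.
  by rewrite linearB e subrr.
have lin : linear (h \o t).
  by move=> a u v; rewrite /= -linearP; apply: eqh; rewrite linearP !st.
by exists (mklin lin) => x /=; apply: eqh; rewrite st.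
Qed.

Lemma factor_inj (X K Y : lmodType R) (i : {linear K -> Y})
    (h : {linear X -> Y}) :
  injective i -> (forall x, exists z, i z = h x) ->
  exists h' : {linear X -> K}, forall x, i (h' x) = h x.
Proof.
move=> iI ih; pose t x := sval (cid (ih x)).
have it x : i (t x) = h x by rewrite /t; case: cid.
have lin : linear t by move=> a u v; apply: iI; rewrite linearP !it linearP.
by exists (mklin lin) => x /=; rewrite it.
Qed.

Lemma linear_inj0 (X Y : lmodType R) (f : {linear X -> Y}) :
  (forall x, f x = 0 -> x = 0) -> injective f.
Proof.
move=> f0 x y e; apply/eqP; rewrite -subr_eq0; apply/eqP/f0.
by rewrite linearB e subrr.
Qed.

Lemma fg_quotient (X : fgmod R) (Y : lmodType R) (s : {linear X -> Y}) :
  surjective s -> finitely_generated Y.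
Proof.
move=> sS; case: (fgmod_fg X) => l hl.
exists (map s l) => y; have [x <-] := sS y; have [c ->] := hl x.
have sz : size (map s l) = size l by rewrite size_map.
exists (fun i => c (cast_ord sz i)).
rewrite linear_sum (reindex (cast_ord sz)) /=; last first.
  by apply: onW_bij; exists (cast_ord (esym sz));
    [exact: cast_ordK | exact: cast_ordKV].
apply: eq_bigr => i _; rewrite linearZ /= (nth_map 0) //.
by rewrite -[X in (_ < X)%N]sz ltn_ord.
Qed.

End LinearMaps.

Section Image.
Variables (R : nzRingType) (X Y : lmodType R) (f : {linear X -> Y}).

Definition img_pred : {pred Y} := fun y => `[< exists x, f x = y >].

Fact img_submod : submod_closed img_pred.
Proof.
split=> [|a u v]; rewrite ?unfold_in.
  by apply/asboolP; exists 0; rewrite linear0.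
move=> /asboolP[x <-] /asboolP[y <-].
by apply/asboolP; exists (a *: x + y); rewrite linearP.
Qed.

HB.instance Definition _ := GRing.isSubmodClosed.Build R Y img_pred img_submod.

Inductive img_type := Img (y : Y) & y \in img_pred.
Definition img_val z := let: @Img y _ := z in y.

HB.instance Definition _ := [isSub for img_val].
HB.instance Definition _ := [Choice of img_type by <:].
HB.instance Definition _ := [SubChoice_isSubLmodule of img_type by <:].

End Image.

Section Splittings.
Variable R : nzRingType.
Implicit Types X Y Z T P I K : fgmod R.

Lemma image_exists X (Y : lmodType R) (f : {linear X -> Y}) :
  exists (K : fgmod R) (s : {linear X -> K}) (i : {linear K -> Y}),
    [/\ surjective s, injective i & forall x, i (s x) = f x].
Proof.
pose i : {linear img_type f -> Y} := val.
have iI : injective i by exact: val_inj.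
have [|s hs] := factor_inj (h := f) iI.
  move=> x; have fx : f x \in img_pred f.
    by rewrite unfold_in; apply/asboolP; exists x.
  by exists (Img fx).
have sS : surjective s.
  move=> z; have /asboolP[x fx] : val z \in img_pred f by exact: valP.
  by exists x; apply: iI; rewrite hs fx.
by exists (FgMod (fg_quotient sS)), s, i.
Qed.

Lemma projective_lift P X Y (Z : lmodType R) (f : {linear X -> Y})
    (g : {linear Y -> Z}) (h : {linear P -> Y}) :
  projective P -> exact_at f g -> (forall x, g (h x) = 0) ->
  exists h' : {linear P -> X}, forall x, f (h' x) = h x.
Proof.
move=> pP ex gh; have [K [s [i [sS iI is_]]]] := image_exists f.
have [|h1 h1E] := factor_inj (h := h) iI.
  by move=> x; have [z zE] := (ex (h x)).1 (gh x); exists (s z); rewrite is_.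
have [h2 h2E] := pP _ _ _ h1 sS.
by exists h2 => x; rewrite -is_ h2E h1E.
Qed.

Lemma injective_extend I (X : lmodType R) Y Z (f : {linear X -> Y})
    (g : {linear Y -> Z}) (h : {linear Y -> I}) :
  injective_mod I -> exact_at f g -> (forall x, h (f x) = 0) ->
  exists h' : {linear Z -> I}, forall y, h' (g y) = h y.
Proof.
move=> iI ex hf; have [K [s [i [sS iJ is_]]]] := image_exists g.
have [|h1 h1E] := factor_surj (h := h) sS.
  move=> y sy; have /ex[x <-] : g y = 0 by rewrite -is_ sy linear0.
  exact: hf.
have [h2 h2E] := iI _ _ _ h1 iJ.
by exists h2 => y; rewrite -is_ h2E h1E.
Qed.

Lemma bij_inverse (X Y : lmodType R) (f : {linear X -> Y}) :
  injective f -> surjective f ->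
  exists g : {linear Y -> X}, cancel f g /\ cancel g f.
Proof.
move=> fI fS; have [g gE] := factor_inj (h := idfun) fI fS.
by exists g; split=> // x; apply: fI; rewrite gE.
Qed.

Lemma iso_inverse X Y : iso X Y ->
  exists (f : {linear X -> Y}) (g : {linear Y -> X}), cancel f g /\ cancel g f.
Proof.
move=> [f fB]; have [g [fg gf]] : exists g : {linear Y -> X},
    cancel f g /\ cancel g f.
  apply: bij_inverse; first exact: bij_inj.
  by case: fB => g fg gf y; exists (g y); rewrite gf.
by exists f, g.
Qed.

Lemma iso_of_cancel X Y (f : {linear X -> Y}) (g : {linear Y -> X}) :
  cancel f g -> cancel g f -> iso X Y.
Proof. by move=> fg gf; exists f; exists g. Qed.

Lemma iso_refl X : iso X X.
Proof. by exists idfun; exists id. Qed.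

Lemma iso_sym X Y : iso X Y -> iso Y X.
Proof. by move=> /iso_inverse[f [g [fg gf]]]; exact: iso_of_cancel gf fg. Qed.

Lemma iso_trans X Y Z : iso X Y -> iso Y Z -> iso X Z.
Proof.
by move=> [f fB] [g gB]; exists (g \o f); exact: bij_comp.
Qed.

Definition in1 X Y : {linear X -> dsum X Y} :=
  @mklin R X (dsum X Y) (fun x => (x, 0)) (fun a u v =>
    congr1 (pair _) (esym (etrans (addr0 _) (scaler0 _ _)))).
Definition in2 X Y : {linear Y -> dsum X Y} :=
  @mklin R Y (dsum X Y) (fun y => (0, y)) (fun a u v =>
    congr1 (pair^~ _) (esym (etrans (addr0 _) (scaler0 _ _)))).
Definition out1 X Y : {linear dsum X Y -> X} :=
  @mklin R (dsum X Y) X (fun z => z.1) (fun a u v => erefl).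
Definition out2 X Y : {linear dsum X Y -> Y} :=
  @mklin R (dsum X Y) Y (fun z => z.2) (fun a u v => erefl).

Fact copair_linear X Y (Z : lmodType R) (f : {linear X -> Z})
  (g : {linear Y -> Z}) : linear (fun z : dsum X Y => f z.1 + g z.2).
Proof. by move=> a u v; rewrite !linearP scalerDr addrACA. Qed.

Definition copair X Y (Z : lmodType R) (f : {linear X -> Z})
    (g : {linear Y -> Z}) : {linear dsum X Y -> Z} :=
  mklin (copair_linear f g).

Fact pairing_linear (Z : lmodType R) X Y (f : {linear Z -> X})
  (g : {linear Z -> Y}) : linear (fun z => (f z, g z) : dsum X Y).
Proof. by move=> a u v; rewrite !linearP. Qed.

Definition pairing (Z : lmodType R) X Y (f : {linear Z -> X})
    (g : {linear Z -> Y}) : {linear Z -> dsum X Y} :=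
  mklin (pairing_linear f g).

Lemma copairE X Y (Z : lmodType R) (f : {linear X -> Z}) (g : {linear Y -> Z})
  x y : copair f g (x, y) = f x + g y.
Proof. by []. Qed.

Lemma pairingE (Z : lmodType R) X Y (f : {linear Z -> X}) (g : {linear Z -> Y})
  z : pairing f g z = (f z, g z).
Proof. by []. Qed.

Lemma dsum_split X Y (z : dsum X Y) : z = in1 X Y z.1 + in2 X Y z.2.
Proof. by case: z => x y /=; congr pair; rewrite /= ?addr0 ?add0r. Qed.

Lemma iso_dsum X X' Y Y' : iso X X' -> iso Y Y' -> iso (dsum X Y) (dsum X' Y').
Proof.
move=> /iso_inverse[f [f' [ff' f'f]]] /iso_inverse[g [g' [gg' g'g]]].
apply: (@iso_of_cancel _ _ (pairing (f \o out1 X Y) (g \o out2 X Y))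
  (pairing (f' \o out1 X' Y') (g' \o out2 X' Y'))) => -[x y];
  by rewrite !pairingE /= ?(ff', gg') ?(f'f, g'g).
Qed.

Lemma iso_dsumC X Y : iso (dsum X Y) (dsum Y X).
Proof.
by apply: (@iso_of_cancel _ _ (pairing (out2 X Y) (out1 X Y))
  (pairing (out2 Y X) (out1 Y X))) => -[x y]; rewrite !pairingE.
Qed.

Lemma iso_dsumA X Y Z : iso (dsum X (dsum Y Z)) (dsum (dsum X Y) Z).
Proof.
pose D := dsum X (dsum Y Z); pose D' := dsum (dsum X Y) Z.
pose f : {linear D -> D'} :=
  pairing (pairing (out1 _ _) (out1 _ _ \o out2 _ _)) (out2 _ _ \o out2 _ _).
pose g : {linear D' -> D} :=
  pairing (out1 _ _ \o out1 _ _) (pairing (out2 _ _ \o out1 _ _) (out2 _ _)).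
by apply: (@iso_of_cancel _ _ f g) => [[x [y z]]|[[x y] z]];
  rewrite !pairingE /= ?pairingE.
Qed.

Lemma zero_is_zero : is_zero (zero_mod R).
Proof. by move=> x; apply/rowP; case. Qed.

Lemma iso_dsum0 X Y : is_zero Y -> iso (dsum X Y) X.
Proof.
move=> Y0; apply: (@iso_of_cancel _ _ (out1 X Y) (in1 X Y)) => //.
by move=> [x y] /=; rewrite (Y0 y).
Qed.

Lemma split_complement X Y (s : {linear X -> Y}) (r : {linear Y -> X}) :
  cancel s r ->
  exists (K : fgmod R) (i : {linear K -> Y}) (q : {linear Y -> K}),
   [/\ forall z, r (i z) = 0, cancel i q, forall y, s (r y) + i (q y) = y
     & iso (dsum X K) Y].
Proof.
move=> sr; pose f : {linear Y -> Y} := idfun \- (s \o r).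
have [K [q [i [qS iI iq]]]] := image_exists f.
have ri z : r (i z) = 0.
  by have [y <-] := qS z; rewrite iq /f /= linearB /= sr subrr.
have qi : cancel i q.
  by move=> z; apply: iI; rewrite iq /f /= ri linear0 subr0.
have sriq y : s (r y) + i (q y) = y by rewrite iq /f /= addrC subrK.
exists K, i, q; split=> //.
apply: (@iso_of_cancel _ _ (copair s i) (pairing r q)) => [[x z]|y].
  rewrite copairE pairingE !linearD ri sr addr0 qi.
  suff -> : q (s x) = 0 by rewrite add0r.
  by apply: iI; rewrite iq /f /= sr subrr linear0.
by rewrite pairingE copairE.
Qed.

End Splittings.

(** * Maps factoring through sums of copies of a module *)

Section Through.
Variable R : nzRingType.
Implicit Types X Y Z T P I : fgmod R.

(** Membership in add T is handled through families of maps X -> T -> X adding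
    up to the identity; this avoids direct sums with an explicit number of
    summands. *)
Definition through T (X Y : lmodType R) (h : X -> Y) : Prop :=
  exists l : seq ({linear X -> T} * {linear T -> Y})%type,
    forall x, h x = \sum_(q <- l) q.2 (q.1 x).

Definition in_add T (X : lmodType R) : Prop := through T (@id X).

Lemma eq_through T (X Y : lmodType R) (h h' : X -> Y) :
  h =1 h' -> through T h -> through T h'.
Proof. by move=> e [l hl]; exists l => x; rewrite -e. Qed.

Lemma through_dsums n T (X Y : lmodType R) (b : {linear X -> dsums (nseq n T)})
  (g : {linear dsums (nseq n T) -> Y}) : through T (g \o b).
Proof.
elim: n => [|n IHn] /= in b g *.
  by exists [::] => x; rewrite big_nil /= (zero_is_zero (b x)) linear0.
have [l hl] := IHn (out2 _ _ \o b) (g \o in2 _ _).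
exists ((out1 _ _ \o b : {linear X -> T},
         g \o in1 _ _ : {linear T -> Y}) :: l) => x.
by rewrite big_cons -hl /= -linearD -dsum_split.
Qed.

Lemma through_tuple T (X Y : lmodType R)
    (l : seq ({linear X -> T} * {linear T -> Y})%type) :
  exists (s : {linear X -> dsums (nseq (size l) T)})
         (r : {linear dsums (nseq (size l) T) -> Y}),
    forall x, r (s x) = \sum_(q <- l) q.2 (q.1 x).
Proof.
elim: l => [|q l [s [r sr]]] /=.
  by exists \0, \0 => x; rewrite big_nil.
exists (pairing q.1 s), (copair q.2 r) => x.
by rewrite pairingE copairE big_cons sr.
Qed.

Lemma through_comp T (X' X Y Y' : lmodType R) (f : {linear X' -> X})
    (h : X -> Y) (g : {linear Y -> Y'}) :
  through T h -> through T (g \o h \o f).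
Proof.
move=> [l hl]; 
exists (map (fun q : ({linear X -> T} * {linear T -> Y})%type =>
  (q.1 \o f : {linear X' -> T}, g \o q.2 : {linear T -> Y'})) l) => x /=.
by rewrite hl linear_sum big_map.
Qed.

Lemma through_add T (X Y : lmodType R) (h h' : X -> Y) :
  through T h -> through T h' -> through T (fun x => h x + h' x).
Proof.
by move=> [l hl] [l' hl']; exists (l ++ l') => x; rewrite big_cat hl hl'.
Qed.

Lemma in_add_of T X : in_add T X -> add_of T X.
Proof.
move=> [l hl]; have [s [r sr]] := through_tuple l.
have [|K [i [q [_ _ _ isoK]]]] := @split_complement _ _ _ s r.
  by move=> x; rewrite sr -hl.
by exists (size l), K.
Qed.

Lemma in_add_refl T : in_add T T.
Proof.
exists [:: (idfun : {linear T -> T}, idfun : {linear T -> T})] => x.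
by rewrite big_seq1.
Qed.

Lemma in_add_retract T (X Y : lmodType R) (s : {linear X -> Y})
    (r : {linear Y -> X}) :
  cancel s r -> in_add T Y -> in_add T X.
Proof.
by move=> sr aY; apply: eq_through (through_comp s r aY) => x /=; rewrite sr.
Qed.

Lemma in_add_zero T X : is_zero X -> in_add T X.
Proof. by move=> X0; exists [::] => x; rewrite big_nil; exact: X0. Qed.

Lemma in_add_dsum T X Y : in_add T X -> in_add T Y -> in_add T (dsum X Y).
Proof.
move=> aX aY.
have := through_add (through_comp (out1 X Y) (in1 X Y) aX)
                    (through_comp (out2 X Y) (in2 X Y) aY).
by apply: eq_through => z /=; rewrite -dsum_split.
Qed.

Lemma through_in_add S T (X Y : lmodType R) (h : X -> Y) :
  in_add S T -> through T h -> through S h.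
Proof.
move=> aT [l hl].
suff [l' hl'] : through S (fun x => \sum_(q <- l) q.2 (q.1 x)).
  by exists l' => x; rewrite hl hl'.
elim: l {h hl} => [|q l IHl]; first by exists [::] => x; rewrite !big_nil.
apply: eq_through (through_add (through_comp q.1 q.2 aT) IHl) => x.
by rewrite big_cons.
Qed.

Lemma in_add_dsuml T X Y : in_add T X -> in_add (dsum T Y) X.
Proof.
by apply: through_in_add;
  apply: (in_add_retract (s := in1 T Y) (r := out1 T Y)) (in_add_refl _).
Qed.

Lemma in_add_dsumr T X Y : in_add T X -> in_add (dsum Y T) X.
Proof.
by apply: through_in_add;
  apply: (in_add_retract (s := in2 Y T) (r := out2 Y T)) (in_add_refl _).
Qed.

Lemma in_add_nseq T n : in_add T (dsums (nseq n T)).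
Proof.
elim: n => [|n IHn]; first exact: (in_add_zero T (@zero_is_zero R)).
exact: (in_add_dsum (in_add_refl T) IHn).
Qed.

(** ** Vanishing of Hom *)

Definition no_hom (X Y : lmodType R) : Prop :=
  forall (h : {linear X -> Y}) x, h x = 0.

Lemma no_hom_addl T (X Y : lmodType R) :
  in_add T X -> no_hom T Y -> no_hom X Y.
Proof.
move=> [l hl] T0 h x; rewrite (hl x) linear_sum big1 // => q _.
exact: (T0 (h \o q.2)).
Qed.

Lemma no_hom_addr T (X Y : lmodType R) :
  in_add T Y -> no_hom X T -> no_hom X Y.
Proof.
move=> [l hl] T0 h x; rewrite [h x]hl big1 // => q _.
by have /= -> := T0 (q.1 \o h) x; rewrite linear0.
Qed.

Lemma no_hom_surj (X Y Z : lmodType R) (p : {linear X -> Y}) :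
  surjective p -> no_hom X Z -> no_hom Y Z.
Proof. by move=> pS X0 h y; have [x <-] := pS y; exact: (X0 (h \o p)). Qed.

Lemma no_hom_dsum X Y Z : no_hom X Z -> no_hom Y Z -> no_hom (dsum X Y) Z.
Proof.
move=> X0 Y0 h z; rewrite [z]dsum_split linearD.
have /= -> := X0 (h \o in1 X Y) z.1.
by have /= -> := Y0 (h \o in2 X Y) z.2; rewrite addr0.
Qed.

(** ** Projective and injective modules *)

Lemma projective_retract X Y (s : {linear X -> Y}) (r : {linear Y -> X}) :
  cancel s r -> projective Y -> projective X.
Proof.
move=> sr pY V W p f pS; have [g gE] := pY _ _ p (f \o r) pS.
by exists (g \o s) => x /=; rewrite gE /= sr.
Qed.

Lemma injective_retract X Y (s : {linear X -> Y}) (r : {linear Y -> X}) :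
  cancel s r -> injective_mod Y -> injective_mod X.
Proof.
move=> sr iY V W j f jI; have [g gE] := iY _ _ j (s \o f) jI.
by exists (r \o g) => x /=; rewrite gE /= sr.
Qed.

Lemma projective_of_in_add T X : projective T -> in_add T X -> projective X.
Proof.
move=> pT [l hl]; have [s [r rs]] := through_tuple l.
apply: (@projective_retract _ _ s r); first by move=> x; rewrite rs -hl.
elim: (size l) => [|n IHn] V W p f pS.
  by exists \0 => x; rewrite (zero_is_zero x) !linear0.
have [g gE] := pT _ _ p (f \o in1 _ _) pS.
have [h hE] := IHn _ _ p (f \o in2 _ _) pS.
by exists (copair g h) => -[x y]; rewrite copairE linearD gE hE /= -linearD
  -(dsum_split (x, y)).
Qed.

Lemma projective_zero X : is_zero X -> projective X.
Proof.
move=> X0 V W p f pS; exists \0 => x.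
by rewrite (X0 x) !linear0.
Qed.

Lemma projective_dsum X Y : projective X -> projective Y ->
  projective (dsum X Y).
Proof.
move=> pX pY V W p f pS.
have [g gE] := pX _ _ p (f \o in1 X Y) pS.
have [h hE] := pY _ _ p (f \o in2 X Y) pS.
by exists (copair g h) => -[x y]; rewrite copairE linearD gE hE /= -linearD
  -(dsum_split (x, y)).
Qed.

Definition scalemap (X : lmodType R) (x : X) : {linear regular_mod R -> X} :=
  @mklin R (regular_mod R) X (fun a => (a : R) *: x) (fun a u v => etrans
    (scalerDl x (a * u) v) (congr1 (+%R^~ (v *: x)) (esym (scalerA a u x)))).

Lemma regular_hom (X : lmodType R) (f : {linear regular_mod R -> X}) a :
  f a = (a : R) *: f (1 : R).
Proof. by rewrite -linearZ /= /GRing.scale /= mulr1. Qed.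

Lemma projective_regular : projective (regular_mod R).
Proof.
move=> V W p f pS; have [y yE] := pS (f (1 : R)).
by exists (scalemap y) => x; rewrite linearZ /= yE -regular_hom.
Qed.

Lemma Fac_of_sums T X :
  (forall x : X, exists l : seq (T * {linear T -> X})%type,
     x = \sum_(q <- l) q.2 q.1) -> Fac T X.
Proof.
move=> hT.
pose covers n (p : {linear dsums (nseq n T) -> X}) x := exists z, p z = x.
have add1 n p (l : seq (T * {linear T -> X})%type) :
    exists m p', (forall x, covers n p x -> covers m p' x) /\
      covers m p' (\sum_(q <- l) q.2 q.1).
  elim: l => [|q l [m [p' [pp' [z zE]]]]].
    by exists n, p; split=> //; exists 0; rewrite linear0 big_nil.
  exists m.+1, (copair q.2 p'); split.
    move=> x /pp'[y <-]; exists (0, y); rewrite copairE.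
    by rewrite linear0 add0r.
  by exists (q.1, z); rewrite copairE big_cons zE.
case: (fgmod_fg X) => s hs.
suff [n [p np]] : exists n p, forall x, x \in s -> covers n p x.
  exists n, p => x; have [c ->] := hs x.
  suff [z zE] : exists z : 'I_(size s) -> dsums (nseq n T),
      forall i, p (z i) = s`_i.
    exists (\sum_i c i *: z i); rewrite linear_sum.
    by apply: eq_bigr => i _; rewrite linearZ /= zE.
  have np' i : covers n p s`_(i : 'I_(size s)) by apply: np; exact: mem_nth.
  by exists (fun i => sval (cid (np' i))) => i; case: cid.
elim: {hs} s => [|x s [n [p np]]]; first by exists 0, \0.
have [l xE] := hT x; have [m [p' [pp' px]]] := add1 n p l.
exists m, p' => y; rewrite inE => /orP[/eqP->|/np/pp'//].
by rewrite xE.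
Qed.

Lemma Fac_regular X : Fac (regular_mod R) X.
Proof.
apply: Fac_of_sums => x; exists [:: ((1 : R) : regular_mod R, scalemap x)].
by rewrite big_seq1 /= scale1r.
Qed.

Lemma projective_in_add X : projective X -> in_add (regular_mod R) X.
Proof.
move=> pX; have [n [p pS]] := Fac_regular X.
have [g gE] := pX _ _ p idfun pS.
exact: in_add_retract gE (in_add_nseq _ _).
Qed.

Lemma Fac_in_add S T X : in_add S T -> Fac T X -> Fac S X.
Proof.
move=> aT [n [p pS]]; apply: Fac_of_sums => x; have [z <-] := pS x.
have [l hl] := through_in_add aT (in_add_nseq T n).
exists (map (fun q : ({linear dsums (nseq n T) -> S} *
    {linear S -> dsums (nseq n T)})%type =>
  (q.1 z, p \o q.2 : {linear S -> X})) l).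
by rewrite big_map {1}(hl z) linear_sum.
Qed.

Lemma no_hom_Fac T X (Y : lmodType R) : Fac T X -> no_hom T Y -> no_hom X Y.
Proof.
move=> [n [p pS]] T0.
exact: no_hom_surj pS (no_hom_addl (in_add_nseq _ _) T0).
Qed.

Section Subcategory.
Variable M : fgmod R -> Prop.
Hypothesis Msub : subcategory M.

Lemma sub_zero X : is_zero X -> M X.
Proof.
case: Msub => h h0 _ _ X0; apply: h h0.
apply: (@iso_of_cancel _ _ _ \0 \0) => x /=; last exact/esym/X0.
exact/esym/zero_is_zero.
Qed.

Lemma sub_dsum X Y : M X -> M Y -> M (dsum X Y).
Proof. by case: Msub => _ _ h _; exact: h. Qed.

Lemma sub_in_add T X : M T -> in_add T X -> M X.
Proof.
case: Msub => h h0 hD hS MT /in_add_of[n [Y isoXY]].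
suff /(h _ _ (iso_sym isoXY))/hS[] : M (dsums (nseq n T)) by [].
by elim: n {isoXY} => //= n IHn; apply: hD.
Qed.

Lemma sub_retract X Y (s : {linear X -> Y}) (r : {linear Y -> X}) :
  cancel s r -> M Y -> M X.
Proof.
by move=> sr MY; apply: sub_in_add MY (in_add_retract sr (in_add_refl _)).
Qed.

End Subcategory.
End Through.

(** * Resolutions and Ext *)

Section Resolutions.
Variable R : nzRingType.
Implicit Types X Y Z T N I : fgmod R.

Lemma dependent_choice (T : nat -> Type) (G : forall n, T n -> Prop)
    (S : forall n, T n -> T n.+1 -> Prop) :
  (exists x, G 0 x) -> (forall n x, G n x -> exists y, G n.+1 y /\ S n x y) ->
  exists s : forall n, T n, G 0 (s 0) /\ forall n, S n (s n) (s n.+1).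
Proof.
move=> /cid[x0 Gx0] step.
pose next n (z : {x | G n x}) : {x | G n.+1 x} :=
  let y := cid (step n (sval z) (svalP z)) in exist _ (sval y) (svalP y).1.
pose s := nat_rect (fun n => {x | G n x}) (exist _ x0 Gx0) next.
exists (fun n => sval (s n)); split=> [//|n].
exact: (svalP (cid (step n (sval (s n)) (svalP (s n))))).2.
Qed.

Lemma exact_comp (X Y Z : lmodType R) (f : {linear X -> Y})
  (g : {linear Y -> Z}) : exact_at f g -> forall x, g (f x) = 0.
Proof. by move=> ex x; apply/ex; exists x. Qed.

Lemma exact_sub (X Y Z : lmodType R) (f : {linear X -> Y})
    (g : {linear Y -> Z}) :
  (forall x, g (f x) = 0) -> (forall y, g y = 0 -> exists x, f x = y) ->
  exact_at f g.
Proof. by move=> gf ex y; split=> [/ex//|[x <-]]. Qed.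

Definition dmap X X' Y Y' (f : {linear X -> X'}) (g : {linear Y -> Y'}) :
    {linear dsum X Y -> dsum X' Y'} :=
  pairing (f \o out1 X Y) (g \o out2 X Y).

Lemma dmapE X X' Y Y' (f : {linear X -> X'}) (g : {linear Y -> Y'}) x y :
  dmap f g (x, y) = (f x, g y).
Proof. by rewrite pairingE. Qed.

Lemma exact_dmap X X' X'' Y Y' Y'' (f : {linear X -> X'})
    (f' : {linear X' -> X''}) (g : {linear Y -> Y'}) (g' : {linear Y' -> Y''}) :
  exact_at f f' -> exact_at g g' -> exact_at (dmap f g) (dmap f' g').
Proof.
move=> ef eg; apply: exact_sub => [[x y]|[x y]]; rewrite !dmapE.
  by rewrite (exact_comp ef) (exact_comp eg).
by case=> /ef[x' <-] /eg[y' <-]; exists (x', y'); rewrite dmapE.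
Qed.

(** ** Projective resolutions *)

Definition projective_resolution X (P : nat -> fgmod R)
    (e : {linear P 0%N -> X}) (f : forall i, {linear P i.+1 -> P i}) : Prop :=
  resolution e f /\ forall i, projective (P i).

Lemma projective_resolution_dsum X Y P e f P' e' f' :
  @projective_resolution X P e f -> @projective_resolution Y P' e' f' ->
  @projective_resolution (dsum X Y) (fun n => dsum (P n) (P' n))
    (dmap e e') (fun n => dmap (f n) (f' n)).
Proof.
move=> [[eS ex0 ex] pP] [[eS' ex0' ex'] pP']; split; last first.
  by move=> n; apply: projective_dsum.
split; last by move=> n; apply: exact_dmap.
  by move=> [x y]; have [[a <-] [b <-]] := (eS x, eS' y); exists (a, b);
    rewrite dmapE.
exact: exact_dmap.
Qed.

Lemma trivial_resolution X : projective X ->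
  exists P e f, @projective_resolution X P e f /\
    forall n, (0 < n)%N -> is_zero (P n).
Proof.
move=> pX; pose P n := if n is 0 then X else zero_mod R.
have P0 n : (0 < n)%N -> is_zero (P n).
  by case: n => // n _; exact: zero_is_zero.
exists P, idfun, (fun=> \0); split=> //; split; first split.
- by move=> x; exists x.
- by move=> x; split=> /= [->|[y <-]] //; exists 0.
- move=> n x; split=> _ //.
  by exists 0; apply/esym; exact: P0.
- by case=> // n; apply: projective_zero; exact: zero_is_zero.
Qed.

Lemma hom_exact_zero (P : nat -> fgmod R) f Y n :
  is_zero (P n.+1) -> @hom_complex_exact R P f Y n.+1.
Proof. by move=> P0 h _; exists \0 => x; rewrite (P0 x) !linear0. Qed.

Lemma ext_zero_projective n X Y : projective X -> ext_zero n.+1 X Y.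
Proof.
move=> /trivial_resolution[P [e [f [[res pP] P0]]]].
by exists P, e, f; split=> //; apply: hom_exact_zero; exact: P0.
Qed.

Lemma hom_exact_injective (P : nat -> fgmod R) f Y n :
  exact_at (f n.+1) (f n) -> injective_mod Y -> @hom_complex_exact R P f Y n.+1.
Proof.
move=> ex iY h hf; have [g gE] := injective_extend iY ex hf.
by exists g => x; rewrite gE.
Qed.

Lemma hom_exact_dsum (P P' : nat -> fgmod R) f f' Y n :
  @hom_complex_exact R P f Y n.+1 -> @hom_complex_exact R P' f' Y n.+1 ->
  @hom_complex_exact R (fun n => dsum (P n) (P' n))
    (fun n => dmap (f n) (f' n)) Y n.+1.
Proof.
move=> ex ex' h h0.
have [|g gE] := ex (h \o in1 _ _).
  by move=> x /=; have := h0 (x, 0); rewrite dmapE linear0.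
have [|g' gE'] := ex' (h \o in2 _ _).
  by move=> x /=; have := h0 (0, x); rewrite dmapE linear0.
exists (copair g g') => -[x y]; rewrite dmapE copairE -gE -gE' /= -linearD.
by rewrite -(dsum_split (x, y)).
Qed.

Lemma ext_zero_dsum n X X' Y :
  ext_zero n.+1 X Y -> ext_zero n.+1 X' Y -> ext_zero n.+1 (dsum X X') Y.
Proof.
move=> [P [e [f [res pP ex]]]] [P' [e' [f' [res' pP' ex']]]].
have [] := projective_resolution_dsum (conj res pP) (conj res' pP').
exists (fun n => dsum (P n) (P' n)), (dmap e e'), (fun n => dmap (f n) (f' n)).
by split=> //; exact: hom_exact_dsum.
Qed.

Lemma chain_lift X X' P e f P' e' f' (u : {linear X -> X'}) :
  @projective_resolution X P e f -> @projective_resolution X' P' e' f' ->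
  exists phi : forall n, {linear P n -> P' n},
    (forall x, e' (phi 0%N x) = u (e x)) /\
    forall n x, f' n (phi n.+1 x) = phi n (f n x).
Proof.
move=> [[eS ex0 ex] pP] [[eS' ex0' ex'] pP'].
pose G n : {linear P n -> P' n} -> Prop := match n with
  | 0 => fun h => forall x, e' (h x) = u (e x)
  | m.+1 => fun h => forall x, f' m (h (f m.+1 x)) = 0 end.
apply: (@dependent_choice _ G (fun n a b =>
  forall x, f' n (b x) = a (f n x))).
  by have [g gE] := pP 0 _ _ e' (u \o e) eS'; exists g.
move=> n h Gh.
have [g gE] : exists g : {linear P n.+1 -> P' n.+1},
    forall x, f' n (g x) = (h \o f n) x.
  case: n => [|n] in h Gh *.
    apply: projective_lift ex0' _; first exact: pP.
    by move=> x; rewrite /= Gh (exact_comp ex0) linear0.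
  by apply: projective_lift (ex' n) _ => //; exact: pP.
exists g; split=> // x; rewrite /G gE /= (exact_comp (ex n)) linear0 //.
Qed.

Lemma chain_null X X' (P : nat -> fgmod R) e f (P' : nat -> fgmod R) e' f'
    (phi : forall n, {linear P n -> P' n}) :
  @projective_resolution X P e f -> @projective_resolution X' P' e' f' ->
  (forall x, e' (phi 0%N x) = 0) ->
  (forall n x, f' n (phi n.+1 x) = phi n (f n x)) ->
  forall n, exists (s : {linear P n -> P' n.+1})
                   (s' : {linear P n.+1 -> P' n.+2}),
    forall x, phi n.+1 x = s (f n x) + f' n.+1 (s' x).
Proof.
move=> [[eS ex0 ex] pP] [[eS' ex0' ex'] pP'] phi0 phiS n.
have step m (s : {linear P m -> P' m.+1}) :
    (forall x, phi m (f m x) = f' m (s (f m x))) ->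
    exists s' : {linear P m.+1 -> P' m.+2},
      forall x, phi m.+1 x = s (f m x) + f' m.+1 (s' x).
  move=> hs; have [|s' s'E] := projective_lift (h := phi m.+1 \- (s \o f m))
    (pP m.+1) (ex' m).
    by move=> x; rewrite /= linearB /= phiS hs subrr.
  by exists s' => x; rewrite s'E /= addrC subrK.
suff [s hs] : exists s : {linear P n -> P' n.+1},
    forall x, phi n (f n x) = f' n (s (f n x)).
  by exists s; exact: step.
elim: n => [|n [s /step[s' hs']]].
  have [s sE] := projective_lift (pP 0) ex0' phi0.
  by exists s => x; rewrite sE.
by exists s' => x; rewrite hs' (exact_comp (ex n)) linear0 add0r.
Qed.

(** Ext may be computed with any resolution: the maps comparing two
    resolutions are homotopy inverse to each other. *)
Lemma hom_exact_of_ext n X Y P e f :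
  @projective_resolution X P e f -> ext_zero n.+1 X Y ->
  hom_complex_exact f Y n.+1.
Proof.
move=> res [P' [e' [f' [resP' pP' exY]]]] h hf.
have res' : projective_resolution e' f' by [].
have [phi [phi0 phiS]] := chain_lift idfun res res'.
have [psi [psi0 psiS]] := chain_lift idfun res' res.
pose chi n : {linear P n -> P n} := (psi n \o phi n) \- idfun.
have [||s [s' hs]] := chain_null (phi := chi) res res _ _ n.
- by move=> x; rewrite /= linearB /= psi0 /= phi0 subrr.
- by move=> m x; rewrite /= linearB /= psiS phiS.
have [|g gE] := exY (h \o psi n.+1).
  by move=> x; rewrite /= -psiS hf.
exists ((g \o phi n) \- (h \o s)) => x /=; rewrite -phiS -gE /=.
have -> : psi n.+1 (phi n.+1 x) = x + s (f n x) + f n.+1 (s' x).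
  by rewrite -addrA -hs /chi /= addrC subrK.
by rewrite !linearD hf addr0 addrK.
Qed.

Lemma ext_of_hom_exact n X Y P e f : @projective_resolution X P e f ->
  hom_complex_exact f Y n -> ext_zero n X Y.
Proof. by move=> [res pP] ex; exists P, e, f. Qed.

(** ** Balance *)

(** Ext^(b+1)(N, X) is also the cohomology of Hom(N, I) for an injective
    coresolution I of X. Inside the double complex Hom(P_a, I_b), the cocycles
    of total degree a + b are moved one antidiagonal step at a time, lifting
    along I and extending along P. *)
Lemma hom_coresolution_exact N X (I : nat -> fgmod R) (e : {linear X -> I 0%N})
    (f : forall i, {linear I i -> I i.+1}) b :
  coresolution e f -> (forall i, injective_mod (I i)) ->
  ext_zero b.+1 N X -> forall h : {linear N -> I b.+1},
  (forall x, f b.+1 (h x) = 0) ->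
  exists g : {linear N -> I b}, forall x, h x = f b (g x).
Proof.
move=> [eI ex0 ex] iI [P [p [q [[pS exp exq] pP exX]]]].
pose bal a b := forall h : {linear P a -> I b.+1},
  (forall x, h (q a x) = 0) -> (forall x, f b.+1 (h x) = 0) ->
  exists g : {linear P a -> I b},
    (forall x, g (q a x) = 0) /\ forall x, f b (g x) = h x.
suff /(_ 0)hbal : forall a, (a + b = b)%N -> bal a b.
  move=> h hf; have [||g [gq gE]] := hbal (erefl _) (h \o p).
  - by move=> x; rewrite /= (exact_comp exp) linear0.
  - by move=> x; rewrite /= hf.
  have [|g' gE'] := factor_surj (h := g) pS.
    by move=> x /exp[y <-].
  by exists g' => x; have [y <-] := pS x; rewrite gE' gE.
suff gen c : forall a, (a + c = b)%N -> bal a c by move=> a; exact: gen.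
elim: c => [|c IHc] a abE h hq hf.
  rewrite addn0 in abE; subst b.
  have [g0 g0E] := projective_lift (pP a) (ex 0) hf.
  have [|c cE] := factor_inj (h := g0 \o q a) eI.
    by move=> x; apply/ex0; rewrite /= g0E hq.
  have [|c' cE'] := exX c.
    by move=> x; apply: eI; rewrite cE /= (exact_comp (exq a)) !linear0.
  exists (g0 \- (e \o c')); split=> x /=.
    by rewrite -cE' cE /= subrr.
  by rewrite linearB /= g0E (exact_comp ex0) subr0.
have [g0 g0E] := projective_lift (pP a) (ex c.+1) hf.
have [||| g1 [g1q g1E]] := IHc a.+1 _ (g0 \o q a).
- by rewrite addSnnS.
- by move=> x; rewrite /= (exact_comp (exq a)) linear0.
- by move=> x; rewrite /= g0E hq.
have [g2 g2E] := injective_extend (iI c) (exq a) g1q.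
exists (g0 \- (f c \o g2)); split=> x /=.
  by rewrite g2E g1E /= subrr.
by rewrite linearB /= g0E (exact_comp (ex c)) subr0.
Qed.

End Resolutions.

(** * Finite-dimensional linear algebra *)

Section FiniteSpan.
Variable k : fieldType.

(** A subfamily whose coordinate rows have maximal rank spans; this works for an
    arbitrary indexing type, such as a set of linear maps. *)
Lemma finite_span (H : Type) (S : H -> Prop) N (ev : H -> 'rV[k]_N) :
  exists m (hs : 'I_m -> H), (forall i, S (hs i)) /\
    forall h, S h -> exists c : 'rV[k]_m,
      ev h = c *m \matrix_i ev (hs i).
Proof.
pose good r := `[< exists m (hs : 'I_m -> H), (forall i, S (hs i)) /\
  \rank (\matrix_i ev (hs i)) = r >].
have good0 : exists r, good r.
  exists (\rank (\matrix_(i < 0) (0 : 'rV[k]_N))); apply/asboolP.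
  have hs : 'I_0 -> H by case.
  exists 0%N, hs; split; first by case.
  by congr (\rank _); apply/row_matrixP; case.
have goodN r : good r -> (r <= N)%N.
  by move=> /asboolP[m [hs [_ <-]]]; exact: rank_leq_col.
case: (ex_maxnP good0 goodN) => r /asboolP[m [hs [hsS rk]]] rmax.
exists m, hs; split=> // h Sh; apply/submxP.
pose hs' (i : 'I_(1 + m)) := match split i with inl _ => h | inr j => hs j end.
have M'E : \matrix_i ev (hs' i) = col_mx (ev h) (\matrix_i ev (hs i)).
  apply/row_matrixP => i; rewrite rowK /hs' -[i]splitK.
  case: (split i) => j /=; first by rewrite (unsplitK (inl _ j)) rowKu row_id.
  by rewrite (unsplitK (inr _ j)) rowKd rowK.
have /rmax : good (\rank (\matrix_i ev (hs' i))).
  apply/asboolP; exists (1 + m)%N, hs'; split=> // i.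
  by rewrite /hs'; case: split.
rewrite M'E -rk => le_rk.
set M := \matrix_i ev (hs i) in le_rk *.
have sMM' : (M <= col_mx (ev h) M)%MS by rewrite -addsmxE addsmxSr.
rewrite (geq_leqif (mxrank_leqif_sup sMM')) in le_rk.
by apply: submx_trans le_rk; rewrite -addsmxE addsmxSl.
Qed.

(** A row vector orthogonal to the kernel of E lies in the row space of E; this
    is what makes a functional a combination of prescribed ones. *)
Lemma row_span_dual m n (v : 'rV[k]_m) (E : 'M[k]_(n, m)) :
  (forall c : 'cV[k]_m, E *m c = 0 -> v *m c = 0) ->
  exists D : 'rV[k]_n, v = D *m E.
Proof.
move=> vE; apply/submxP; rewrite submxE; apply/eqP/matrixP => i j.
have /matrixP/(_ i 0) : v *m col j (cokermx E) = 0.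
  by apply: vE; rewrite colE mulmxA mulmx_coker mul0mx.
by rewrite colE mulmxA -colE !mxE.
Qed.

End FiniteSpan.

Section FiniteDimension.
Variables (k : fieldType) (A : falgType k).
Implicit Types X Y Z I : fgmod A^c.

(** A acts on the right, so k acts on an A-module through the center of A^c. *)
Definition kscale (X : lmodType A^c) (c : k) (x : X) : X :=
  ((c%:A : A) : A^c) *: x.

Definition klinear (X : lmodType A^c) (V : lmodType k) (r : X -> V) : Prop :=
  forall c x y, r (kscale c x + y) = c *: r x + r y.

Lemma kscaleC (X : lmodType A^c) c (a : A^c) (x : X) :
  a *: kscale c x = kscale c (a *: x).
Proof.
rewrite /kscale !scalerA; congr (_ *: _).
by rewrite /GRing.mul /= mulr_algl mulr_algr.
Qed.

Lemma kscaleA (X : lmodType A^c) c d (x : X) :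
  kscale c (kscale d x) = kscale (c * d) x.
Proof.
rewrite /kscale !scalerA; congr (_ *: _).
by rewrite /GRing.mul /= mulr_algl scalerA mulrC.
Qed.

Lemma scale_kscale (X : lmodType A^c) c (a : A) (x : X) :
  ((c *: a : A) : A^c) *: x = kscale c ((a : A^c) *: x).
Proof.
rewrite /kscale !scalerA; congr (_ *: _).
by rewrite [RHS]/GRing.mul /= mulr_algr.
Qed.

Lemma kscaleDr (X : lmodType A^c) c (x y : X) :
  kscale c (x + y) = kscale c x + kscale c y.
Proof. exact: scalerDr. Qed.

Lemma kscaleDl (X : lmodType A^c) c d (x : X) :
  kscale (c + d) x = kscale c x + kscale d x.
Proof. by rewrite /kscale -scalerDl -scalerDl. Qed.

Lemma kscaleN1 (X : lmodType A^c) (x : X) : kscale (-1) x = - x.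
Proof. by rewrite /kscale scaleN1r scaleN1r. Qed.

Lemma kscale_sum (X : lmodType A^c) c (J : Type) (l : seq J) (F : J -> X) :
  kscale c (\sum_(j <- l) F j) = \sum_(j <- l) kscale c (F j).
Proof. exact: scaler_sumr. Qed.

Lemma kscale_linear (X Y : lmodType A^c) (h : {linear X -> Y}) c x :
  h (kscale c x) = kscale c (h x).
Proof. exact: linearZ. Qed.

Section Klinear.
Variables (X : lmodType A^c) (V : lmodType k) (r : X -> V).
Hypothesis rlin : klinear r.

Lemma klinearD x y : r (x + y) = r x + r y.
Proof.
have := rlin 1 x y; rewrite scale1r => <-; congr (r (_ + _)).
by rewrite /kscale scale1r [RHS]scale1r.
Qed.

Lemma klinear0 : r 0 = 0.
Proof. by apply: (addrI (r 0)); rewrite -klinearD !addr0. Qed.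

Lemma klinearZ c x : r (kscale c x) = c *: r x.
Proof. by have := rlin c x 0; rewrite !addr0 klinear0 addr0. Qed.

Lemma klinearB x y : r (x - y) = r x - r y.
Proof. by apply: (addIr (r y)); rewrite -klinearD !subrK. Qed.

Lemma klinear_sum (J : Type) (l : seq J) (F : J -> X) :
  r (\sum_(j <- l) F j) = \sum_(j <- l) r (F j).
Proof.
elim: l => [|j l IHl]; first by rewrite !big_nil klinear0.
by rewrite !big_cons klinearD IHl.
Qed.

End Klinear.

Definition lincomb (X Y : lmodType A^c) m (c : 'I_m -> k)
    (hs : 'I_m -> {linear X -> Y}) : {linear X -> Y}.
apply: (@mklin _ X Y (fun x => \sum_i kscale (c i) (hs i x))).
abstract (move=> a u v; rewrite scaler_sumr -big_split; apply: eq_bigr => i _;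
  by rewrite linearP kscaleDr kscaleC).
Defined.

(** The submodule of relations between a finite k-spanning family is spanned by
    the rows of a matrix, and its cokernel matrix separates the points. *)
Lemma coordinates X : exists N (r : X -> 'rV[k]_N), klinear r /\ injective r.
Proof.
case: (fgmod_fg X) => s hs; pose e := vbasis {:A}.
pose T : finType := ('I_(\dim {:A}) * 'I_(size s))%type.
pose y (t : T) : X := (e`_t.1 : A^c) *: s`_t.2.
pose p (v : 'rV[k]_#|T|) : X := \sum_t kscale (v 0 (enum_rank t)) (y t).
have plin c u v : p (c *: u + v) = kscale c (p u) + p v.
  rewrite /p kscale_sum -big_split; apply: eq_bigr => t _.
  by rewrite !mxE kscaleDl kscaleA.
have pS x : exists v, p v = x.
  have [a aE] := hs x.
  exists (\row_i let t := enum_val i in coord e t.1 (a t.2 : A)).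
  transitivity (\sum_(t : T) kscale (coord e t.1 (a t.2 : A)) (y t)).
    by apply: eq_bigr => t _; rewrite mxE enum_rankK.
  transitivity (\sum_(i < \dim {:A}) \sum_(j < size s)
      kscale (coord e i (a j : A)) ((e`_i : A^c) *: s`_j)).
    by rewrite pair_bigA.
  rewrite [RHS]aE exchange_big; apply: eq_bigr => j _.
  transitivity (((\sum_i coord e i (a j : A) *: e`_i : A) : A^c) *: s`_j).
    rewrite [RHS]scaler_suml.
    by apply: eq_bigr => i _; rewrite -scale_kscale.
  by congr (_ *: _); exact/esym/coord_vbasis/memvf.
have [m [vs [vs0 spanK]]] := finite_span (fun v => p v = 0) id.
set B := \matrix_i _ in spanK.
have pB v : p v = 0 <-> v *m cokermx B = 0.
  split=> [/spanK[c ->]|/eqP]; first by rewrite -mulmxA mulmx_coker mulmx0.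
  rewrite -submxE => /submxP[c ->].
  have p0 : p 0 = 0 by rewrite /p big1 // => t _; rewrite mxE /kscale !scale0r.
  rewrite mulmx_sum_row; elim/big_rec: _ => // i w _ pw.
  by rewrite plin pw rowK /= vs0 /kscale scaler0 addr0.
pose lift x := sval (cid (pS x)).
have liftE x : p (lift x) = x by rewrite /lift; case: cid.
have eqp u v : p u = p v -> u *m cokermx B = v *m cokermx B.
  move=> e1; apply/eqP; rewrite -subr_eq0 -mulmxBl; apply/eqP/pB.
  have := plin (-1) v u; rewrite scaleN1r addrC => ->.
  by rewrite e1 kscaleN1 addNr.
exists _, (fun x => lift x *m cokermx B); split=> [c x x'|x x'].
  by rewrite scalemxAl -mulmxDl; apply: eqp; rewrite plin !liftE.
move=> e1; rewrite -(liftE x) -(liftE x').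
have := plin (-1) (lift x') (lift x); rewrite kscaleN1.
move=> e2; apply/eqP; rewrite -subr_eq0 addrC -e2; apply/eqP/pB.
by rewrite scaleN1r mulmxDl mulNmx e1 addNr.
Qed.

Lemma hom_span X Y (S : {linear X -> Y} -> Prop) :
  exists m (hs : 'I_m -> {linear X -> Y}), (forall i, S (hs i)) /\
    forall h, S h -> exists c, h =1 lincomb c hs.
Proof.
have [N [r [rlin rI]]] := coordinates Y; case: (fgmod_fg X) => s hs.
pose ev (h : {linear X -> Y}) := mxvec (\matrix_(j < size s) r (h s`_j)).
have [m [fs [fsS span]]] := finite_span S ev.
exists m, fs; split=> // h /span[c hE]; exists (c 0) => x.
have hj (j : 'I_(size s)) : h s`_j = lincomb (c 0) fs s`_j.
  apply: rI; rewrite /lincomb /= (klinear_sum rlin).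
  have /(congr1 (row j \o vec_mx)) := hE; rewrite /= mxvecK rowK => ->.
  rewrite mulmx_sum_row !linear_sum; apply: eq_bigr => i _.
  by rewrite !linearZ /= rowK mxvecK rowK (klinearZ rlin).
have [a ->] := hs x; rewrite !linear_sum.
by apply: eq_bigr => j _; rewrite !linearZ /= hj.
Qed.

Lemma functionals_separate X (x : X) :
  (forall r : X -> k^o, klinear r -> r x = 0) -> x = 0.
Proof.
have [N [r [rlin rI]]] := coordinates X => hx; apply: rI.
rewrite (klinear0 rlin); apply/rowP => i; rewrite !mxE.
by apply: (hx (fun x => r x 0 i)) => c u v; rewrite rlin !mxE.
Qed.

End FiniteDimension.

(** * The injective cogenerator DA and the functor Hom(DA, -) *)

Lemma fg_of_span (R : nzRingType) (X : lmodType R) n (ys : 'I_n -> X) :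
  (forall x, exists c, x = \sum_i c i *: ys i) -> finitely_generated X.
Proof.
move=> span; pose s := [tuple ys i | i < n]; exists s => x.
have [c ->] := span x; exists (fun i => c (cast_ord (size_tuple s) i)).
rewrite [RHS](reindex (cast_ord (esym (size_tuple s)))) /=; last first.
  by apply: onW_bij; exists (cast_ord (size_tuple s));
    [exact: cast_ordKV | exact: cast_ordK].
apply: eq_bigr => i _; rewrite cast_ordKV; congr (_ *: _).
by rewrite -(tnth_nth 0 s i) tnth_mktuple.
Qed.

Section Nakayama.
Variables (k : fieldType) (A : falgType k).
Implicit Types X Y Z I J : fgmod A^c.

Local Notation ev f a := ((f : 'Hom(A, k^o)) a).

Lemma dual_scaleE (a : A^c) (f : dual A) (x : A) :
  ev (a *: f) x = ev f ((a : A) * x).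
Proof. exact: dual_ractE. Qed.

Lemma ev_linear a : klinear (fun f : dual A => ev f a : k^o).
Proof.
move=> c f g; rewrite add_lfunE dual_scaleE.
by rewrite mulr_algl linearZ.
Qed.

Lemma to_dual (X : lmodType A^c) (r : X -> k^o) : klinear r ->
  exists g : {linear X -> dual A}, forall x a, ev (g x) a = r ((a : A^c) *: x).
Proof.
move=> rlin.
have lin x : linear (fun a : A => r ((a : A^c) *: x)).
  by move=> c a b; rewrite -rlin -scale_kscale -scalerDl.
pose F x : dual A := linfun (mklin (lin x)).
have FE x a : ev (F x) a = r ((a : A^c) *: x) by rewrite lfunE.
have Flin : linear F.
  move=> b x y; apply/lfunP => a; rewrite add_lfunE dual_scaleE !FE.
  by rewrite scalerDr (klinearD rlin) scalerA.
by exists (mklin Flin).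
Qed.

Lemma dual_fg : finitely_generated (dual A).
Proof.
pose e := vbasis {:A}.
apply: (fg_of_span (ys := fun i => linfun (coord e i : A -> k^o) : dual A)) => f.
exists (fun j : 'I_(\dim {:A}) => ((ev f (e`_j))%:A : A) : A^c).
apply/lfunP => a; rewrite [in LHS](coord_vbasis (memvf a)) linear_sum.
rewrite (klinear_sum (ev_linear a)); apply: eq_bigr => j _.
rewrite dual_scaleE mulr_algl !linearZ /=.
by rewrite lfunE; exact: mulrC.
Qed.

Definition DA : fgmod A^c := FgMod dual_fg.

(** Any functional on a submodule extends: in coordinates, a row vector killed
    by the annihilator of a matrix lies in its row space. *)
Lemma DA_injective : injective_mod DA.
Proof.
move=> Y Z j f jI; pose lam y := ev (f y) 1 : k^o.
have lamlin : klinear lam.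
  move=> c x y; rewrite /lam linearD kscale_linear.
  exact: ev_linear.
have [N [r [rlin rI]]] := coordinates Z.
have [m [ys [_ span]]] :=
  finite_span (fun=> True) (fun y : Y => r (j y)).
set B := \matrix_i _ in span.
have rj (c : 'rV[k]_m) : r (j (\sum_i kscale (c 0 i) (ys i))) = c *m B.
  rewrite linear_sum (klinear_sum rlin) mulmx_sum_row.
  by apply: eq_bigr => i _; rewrite rowK kscale_linear (klinearZ rlin).
have spanY y : exists c : 'rV[k]_m, y = \sum_i kscale (c 0 i) (ys i).
  by have [c cE] := span y I; exists c; apply/jI/rI; rewrite rj.
pose v : 'rV[k]_m := \row_i lam (ys i).
have lamE (c : 'rV[k]_m) : lam (\sum_i kscale (c 0 i) (ys i)) = (v *m c^T) 0 0.
  rewrite (klinear_sum lamlin) mxE; apply: eq_bigr => i _.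
  by rewrite (klinearZ lamlin) !mxE mulrC.
have [c Bc|D vE] := @row_span_dual _ _ _ v B^T.
  apply/matrixP => a b; rewrite !ord1 -[c]trmxK -lamE mxE.
  suff -> : \sum_i kscale (c^T 0 i) (ys i) = 0 by rewrite (klinear0 lamlin).
  apply/jI/rI; rewrite rj linear0 (klinear0 rlin).
  by rewrite -[B]trmxK -trmx_mul Bc trmx0.
pose mu z := (D *m (r z)^T) 0 0 : k^o.
have mulin : klinear mu.
  move=> c x y; rewrite /mu rlin linearP /= mulmxDr -scalemxAr.
  by rewrite 2!mxE.
have [g gE] := to_dual mulin.
exists g => y; apply/lfunP => a; rewrite gE -linearZ.
have [c cE] := spanY ((a : A^c) *: y).
rewrite /mu {1}cE rj trmx_mul mulmxA -vE -lamE -cE /lam linearZ.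
by rewrite dual_scaleE mulr1.
Qed.

(** The coordinate functionals embed I in a finite sum of copies of DA, where it
    splits off by injectivity. *)
Lemma injective_in_add I : injective_mod I -> in_add DA I.
Proof.
have [N [r [rlin rI]]] := coordinates I => iI.
have rilin i : klinear (fun x => r x 0 i : k^o).
  by move=> c x y; rewrite rlin !mxE.
have emb n (b : 'I_n -> {linear I -> DA}) :
    exists s : {linear I -> dsums (nseq n DA)},
      forall x, s x = 0 -> forall i, b i x = 0.
  elim: n => [|n IHn] in b *; first by exists \0 => x _ [].
  have [s hs] := IHn (fun i => b (lift ord0 i)).
  exists (pairing (b ord0) s) => x; rewrite pairingE => -[b0 /hs b1] i.
  by have [j ->|->] := unliftP ord0 i.
have [s hs] := emb N (fun i => sval (cid (to_dual (rilin i)))).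
have sI : injective s.
  apply: linear_inj0 => x /hs x0; apply: rI; rewrite (klinear0 rlin).
  apply/rowP => i; rewrite [RHS]mxE; have := x0 i; case: cid => g gE /= gx.
  by have := gE x 1; rewrite gx lfunE /= scale1r => <-.
have [g gE] := iI _ _ s idfun sI.
by apply: eq_through (through_dsums s g) => x /=; rewrite gE.
Qed.

(** ** End(DA) = A *)

Lemma dual_lact_inj (a b : A) :
  (forall f : dual A, dual_lact a f = dual_lact b f) -> a = b.
Proof.
move=> ab; pose e := vbasis {:A}.
rewrite (coord_vbasis (memvf a)) [RHS](coord_vbasis (memvf b)).
apply: eq_bigr => i _; congr (_ *: _).
have /lfunP/(_ 1) := ab (linfun (coord e i : A -> k^o)).
by rewrite !dual_lactE !mul1r !lfunE.
Qed.

(** An endomorphism q of DA induces the functional f |-> q(f)(1) on DA, which is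
    the evaluation at some element of A. *)
Lemma dual_endo (q : {linear dual A -> dual A}) :
  exists a : A, forall f, q f = dual_lact a f.
Proof.
pose e := vbasis {:A}; pose c i : DA := linfun (coord e i : A -> k^o).
have fE (f : dual A) : f = \sum_(i < \dim {:A}) kscale (ev f e`_i) (c i).
  apply/lfunP => a; rewrite (klinear_sum (ev_linear a)).
  rewrite [in LHS](coord_vbasis (memvf a)) linear_sum.
  by apply: eq_bigr => i _; rewrite (klinearZ (ev_linear a)) linearZ lfunE;
    exact: mulrC.
exists (\sum_(i < \dim {:A}) ev (q (c i)) 1 *: e`_i) => f.
have q1 g : ev (q g) 1 = ev g (\sum_(i < \dim {:A}) ev (q (c i)) 1 *: e`_i).
  rewrite {1}(fE g) linear_sum (klinear_sum (ev_linear 1)) linear_sum.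
  apply: eq_bigr => i _; rewrite kscale_linear (klinearZ (ev_linear 1)).
  by rewrite linearZ; exact: mulrC.
apply/lfunP => x; rewrite dual_lactE -(dual_scaleE (x : A^c)) -q1 linearZ.
by rewrite dual_scaleE mulr1.
Qed.

Definition endo_elt (q : {linear dual A -> dual A}) : A :=
  sval (cid (dual_endo q)).

Lemma endo_eltE (q : {linear dual A -> dual A}) f :
  q f = dual_lact (endo_elt q) f.
Proof. by rewrite /endo_elt; case: cid. Qed.

Lemma endo_elt1 (q : {linear dual A -> dual A}) f :
  ev (q f) 1 = ev f (endo_elt q).
Proof. by rewrite endo_eltE dual_lactE mul1r. Qed.

(** ** Hom(DA, I) for an injective module I *)

Lemma nu_sumE (M : lmodType A^c) (J : Type) (l : seq J) (F : J -> nu_inv M) f :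
  ((\sum_(j <- l) F j : nu_inv M) : {linear dual A -> M}) f =
  \sum_(j <- l) (F j : {linear dual A -> M}) f.
Proof.
elim: l => [|j l IHl]; first by rewrite !big_nil.
by rewrite !big_cons -IHl.
Qed.

(** Under End(DA) = A this is q |-> (b o q) x. Such maps play for nu^- M the
    role of the evaluations at points for a dual space. *)
Definition nu_eval (M : lmodType A^c) (X : lmodType A^c)
  (b : {linear M -> dual A}) (x : X) : {linear nu_inv M -> X}.
apply: (@mklin _ (nu_inv M) X (fun q =>
  (endo_elt (b \o (q : {linear dual A -> M})) : A^c) *: x)).
abstract (move=> a p q; rewrite scalerA -scalerDl; congr (_ *: _);
  apply: dual_lact_inj => f; rewrite -endo_eltE dual_lactD /=;
  rewrite linearD /= -endo_eltE dual_lactM -(endo_eltE (b \o _)) //).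
Defined.

Lemma nu_evalE (M X : lmodType A^c) (b : {linear M -> dual A}) (x : X) q :
  nu_eval b x q = (endo_elt (b \o (q : {linear dual A -> M})) : A^c) *: x.
Proof. by []. Qed.

(** A decomposition of the identity of M through DA exhibits nu^- M as a summand
    of a free module. *)
Lemma nu_frame (M : lmodType A^c)
    (l : seq ({linear M -> DA} * {linear DA -> M})%type) :
  (forall x, x = \sum_(p <- l) p.2 (p.1 x)) ->
  forall q : nu_inv M,
  q = \sum_(p <- l) (endo_elt (p.1 \o (q : {linear dual A -> M})) : A^c)
        *: (p.2 : nu_inv M).
Proof.
move=> hl q; apply: linear_ext => f.
rewrite nu_sumE [LHS]hl; apply: eq_bigr => p _ /=.
by rewrite -endo_eltE.
Qed.

Lemma nu_in_add (M : lmodType A^c) :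
  in_add DA M -> in_add (regular_mod A^c) (nu_inv M).
Proof.
move=> [l /nu_frame hl].
exists [seq (nu_eval p.1 ((1 : A^c) : regular_mod A^c),
             scalemap (p.2 : nu_inv M)) | p <- l] => q.
rewrite {1}[q]hl big_map; apply: eq_bigr => p _ /=.
by congr (_ *: _); apply: esym; exact: (@mulr1 A^c).
Qed.

Lemma fg_in_add (R : nzRingType) (T : fgmod R) (X : lmodType R) :
  in_add T X -> finitely_generated X.
Proof.
move=> [l hl]; have [s [r rs]] := through_tuple l.
by apply: (@fg_quotient _ _ _ r) => x; exists (s x); rewrite rs -hl.
Qed.

Lemma nu_fg I : in_add DA I -> finitely_generated (nu_inv I).
Proof. by move=> /nu_in_add/fg_in_add. Qed.

(** ** Full faithfulness on injective modules *)

Lemma nu_faithful I J (g g' : {linear I -> J}) : in_add DA I ->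
  nu_inv_map g =1 nu_inv_map g' -> g =1 g'.
Proof.
move=> [l hl] gg' x; rewrite (hl x) !linear_sum; apply: eq_bigr => p _.
by have := congr1 (fun q : nu_inv J => (q : {linear dual A -> J}) (p.1 x))
  (gg' p.2).
Qed.

Lemma nu_full I J (eps : {linear nu_inv I -> nu_inv J}) : in_add DA I ->
  exists g : {linear I -> J}, eps =1 nu_inv_map g.
Proof.
move=> [l hl]; pose G x := \sum_(p <- l)
  (eps (p.2 : nu_inv I) : {linear dual A -> J}) (p.1 x).
have Glin : linear G.
  move=> a x y; rewrite /G scaler_sumr -big_split; apply: eq_bigr => p _.
  by rewrite !linearP.
exists (mklin Glin) => q; apply: linear_ext => f.
rewrite {1}(nu_frame hl q) linear_sum nu_sumE /= /G; apply: eq_bigr => p _.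
by rewrite linearZ /= -endo_eltE.
Qed.

(** ** Duality between Hom(-, I) and Hom(nu^- I, -) *)

Lemma nu_no_hom I (X : lmodType A^c) :
  in_add DA I -> no_hom (nu_inv I) X -> no_hom X I.
Proof.
move=> [l hl] nX phi x; rewrite (hl (phi x)) big1 // => p _.
suff -> : p.1 (phi x) = 0 by rewrite linear0.
apply/lfunP => z; rewrite [RHS]lfunE /= {1}(hl (phi x)) linear_sum.
rewrite (klinear_sum (ev_linear z)) big1 // => q _.
have /= -> := endo_eltE (p.1 \o q.2) (q.1 (phi x)); rewrite dual_lactE.
rewrite -[_ * _]mulr1 -(dual_scaleE (_ : A^c)).
set c := endo_elt _; have -> : (z * c : A^c) = (c : A^c) * (z : A^c) by [].
have := nX (nu_eval p.1 ((z : A^c) *: x)) q.2; rewrite nu_evalE scalerA => zx.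
by rewrite -!linearZ zx !linear0 lfunE.
Qed.

(** The pairing between phi : X -> I and h : nu^- I -> X sends them to the
    trace of phi o h, computed from a decomposition of the identity of I as a
    sum of maps I -> DA -> I. It identifies Hom(nu^- I, X) with the dual of
    Hom(X, I), so that exactness at I1 passes from the covariant to the
    contravariant side: the functional attached to h vanishes on the maps killed
    by f1, hence is a combination of evaluations phi |-> b(f1(phi x))(1), and
    these assemble into the wanted map nu^- I2 -> X. *)
Lemma nu_hom_exact X I0 I1 I2
    (f0 : {linear I0 -> I1}) (f1 : {linear I1 -> I2}) :
  in_add DA I0 -> in_add DA I1 -> in_add DA I2 ->
  (forall phi : {linear X -> I1}, (forall x, f1 (phi x) = 0) ->
     exists chi : {linear X -> I0}, forall x, phi x = f0 (chi x)) ->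
  forall h : {linear nu_inv I1 -> X}, (forall q, h (nu_inv_map f0 q) = 0) ->
  exists g : {linear nu_inv I2 -> X}, forall q, h q = g (nu_inv_map f1 q).
Proof.
move=> [l0 hl0] [l1 hl1] [l2 hl2] ex h hf0.
pose Lam (phi : X -> I1) := \sum_(p <- l1) ev (p.1 (phi (h p.2))) 1.
(* Lam is dual to evaluation at the maps that factor through DA. *)
have Lam_dual (r : X -> k^o) (g : {linear X -> dual A}) (a : nu_inv I1) :
    klinear r -> (forall x c, ev (g x) c = r ((c : A^c) *: x)) ->
    Lam ((a : {linear dual A -> I1}) \o g) = r (h a).
  move=> rlin gE; rewrite [in RHS](nu_frame hl1 a) linear_sum (klinear_sum rlin).
  apply: eq_bigr => p _ /=.
  have /= -> := endo_elt1 (p.1 \o (a : {linear dual A -> I1})) (g (h p.2)).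
  by rewrite gE linearZ.
have Lam0 (chi : {linear X -> I0}) : Lam (f0 \o chi) = 0.
  pose c (p : {linear I1 -> DA} * {linear DA -> I1})
    (q : {linear I0 -> DA} * {linear DA -> I0}) := endo_elt (p.1 \o (f0 \o q.2)).
  transitivity (\sum_(p <- l1) \sum_(q <- l0)
      ev (q.1 (chi (h ((c p q : A^c) *: (p.2 : nu_inv I1))))) 1).
    apply: eq_bigr => p _ /=; rewrite {1}(hl0 (chi (h p.2))) !linear_sum.
    rewrite (klinear_sum (ev_linear 1)); apply: eq_bigr => q _.
    have /= -> := endo_elt1 (p.1 \o (f0 \o q.2)) (q.1 (chi (h p.2))).
    by rewrite !linearZ dual_scaleE mulr1.
  rewrite exchange_big big1 // => q _.
  rewrite -(klinear_sum (ev_linear 1)) -!linear_sum.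
  have -> : \sum_(p <- l1) (c p q : A^c) *: (p.2 : nu_inv I1) =
    nu_inv_map f0 q.2 by rewrite [RHS](nu_frame hl1).
  by rewrite hf0 !linear0 lfunE.
have LamZ m (c : 'I_m -> k) (phis : 'I_m -> {linear X -> I1}) :
    Lam (lincomb c phis) = \sum_i c i * Lam (phis i).
  rewrite /Lam; under [RHS]eq_bigr do rewrite mulr_sumr.
  rewrite [RHS]exchange_big; apply: eq_bigr => p _ /=.
  rewrite linear_sum (klinear_sum (ev_linear 1)); apply: eq_bigr => i _.
  by rewrite kscale_linear (klinearZ (ev_linear 1)).
pose E (j : {linear I2 -> DA} * X) (phi : X -> I1) := ev (j.1 (f1 (phi j.2))) 1.
have EZ j m (c : 'I_m -> k) (phis : 'I_m -> {linear X -> I1}) :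
    E j (lincomb c phis) = \sum_i c i * E j (phis i).
  rewrite /E /= !linear_sum (klinear_sum (ev_linear 1)); apply: eq_bigr => i _.
  by rewrite !kscale_linear (klinearZ (ev_linear 1)).
have [m [phis [_ span]]] := @hom_span _ _ X I1 (fun=> True).
have [n [js [_ spanJ]]] := @finite_span k _ (fun=> True) m
  (fun j => \row_i E j (phis i)).
set B := \matrix_i _ in spanJ.
have [c Bc|D vE] := @row_span_dual k _ _ (\row_i Lam (phis i)) B.
  pose phi := lincomb (fun i => c i 0) phis.
  have Ephi j : E j phi = 0.
    have [d dE] := spanJ j I; have := congr1 (mulmx^~ c) dE.
    rewrite -mulmxA Bc mulmx0 => /matrixP/(_ 0 0); rewrite !mxE => <-.
    by rewrite EZ; apply: eq_bigr => i _; rewrite mxE mulrC.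
  have f1phi x : f1 (phi x) = 0.
    rewrite (hl2 (f1 _)) big1 // => p _; suff -> : p.1 (f1 (phi x)) = 0.
      by rewrite linear0.
    apply/lfunP => a; rewrite [RHS]lfunE /=.
    have := Ephi (p.1, (a : A^c) *: x); rewrite /E [(_, _).1]/= [(_, _).2]/=.
    by rewrite !linearZ dual_scaleE mulr1.
  have [chi chiE] := ex phi f1phi.
  have := Lam0 chi; have -> : Lam (f0 \o chi) = Lam phi.
    by apply: eq_bigr => p _; rewrite /= -chiE.
  rewrite LamZ => L0; apply/matrixP => a b; rewrite !ord1 !mxE -[RHS]L0.
  by apply: eq_bigr => i _; rewrite mxE mulrC.
have LamE (phi : {linear X -> I1}) : Lam phi = \sum_i D 0 i * E (js i) phi.
  have [c phiE] := span phi I.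
  have -> : Lam phi = Lam (lincomb c phis).
    by apply: eq_bigr => p _; rewrite phiE.
  rewrite LamZ; under [RHS]eq_bigr => i _.
    have -> : E (js i) phi = E (js i) (lincomb c phis) by rewrite /E phiE.
    rewrite EZ mulr_sumr; over.
  rewrite exchange_big; apply: eq_bigr => i _.
  have /matrixP/(_ 0 i) := vE; rewrite !mxE => ->.
  rewrite mulr_sumr; apply: eq_bigr => j _.
  by rewrite !mxE mulrCA.
exists (lincomb (D 0) (fun i => nu_eval (js i).1 (js i).2)) => a.
apply/eqP; rewrite -subr_eq0; apply/eqP/functionals_separate => r rlin.
have [g gE] := to_dual rlin.
rewrite (klinearB rlin) -(Lam_dual _ _ _ rlin gE).
apply/eqP; rewrite subr_eq0; apply/eqP.
rewrite (LamE (_ \o _)) /= (klinear_sum rlin); apply: eq_bigr => i _.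
rewrite (klinearZ rlin) /=; congr (_ * _); rewrite /E /=.
rewrite -gE -endo_elt1 //.
Qed.

End Nakayama.

(** * Constructions with complexes *)

Section Complexes.
Variable R : nzRingType.
Implicit Types X Y Z T N W : fgmod R.

(** ** Reversing a finite complex *)

(** The complex E_0 -> ... -> E_d read from right to left and padded with zero
    modules. Recursion on both indices avoids transporting along equations such
    as d - n = (d - n.+1).+1. *)
Fixpoint rev_obj (E : nat -> fgmod R) d n {struct n} : fgmod R :=
  match n with
  | 0 => E d
  | n'.+1 => match d with 0 => zero_mod R | d'.+1 => rev_obj E d' n' end
  end.

Fixpoint rev_map (E : nat -> fgmod R) (g : forall i, {linear E i -> E i.+1})
    d n : {linear rev_obj E d n.+1 -> rev_obj E d n} :=
  match d return {linear rev_obj E d n.+1 -> rev_obj E d n} with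
  | 0 => \0
  | d'.+1 =>
    match n return {linear rev_obj E d'.+1 n.+1 -> rev_obj E d'.+1 n} with
    | 0 => g d'
    | n'.+1 => rev_map g d' n'
    end
  end.

Section Reverse.
Variables (E : nat -> fgmod R) (g : forall i, {linear E i -> E i.+1}).

Lemma rev_obj_zero d n : (d < n)%N -> is_zero (rev_obj E d n).
Proof.
elim: d n => [|d IHd] [|n] //= dn; first exact: zero_is_zero.
exact: IHd.
Qed.

Lemma rev_obj_top d : iso (rev_obj E d d) (E 0).
Proof. by elim: d => //=; exact: iso_refl. Qed.

Lemma rev_obj_lower (S : fgmod R -> Prop) d n :
  (forall j, (0 < j)%N -> S (E j)) -> (n < d)%N -> S (rev_obj E d n).
Proof.
by move=> SE; elim: d n => [|d IHd] [|n] //= nd; [exact: SE|exact: IHd].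
Qed.

Lemma rev_obj_all (S : fgmod R -> Prop) d n :
  (forall j, S (E j)) -> S (zero_mod R) -> S (rev_obj E d n).
Proof. by move=> SE S0; elim: d n => [|d IHd] [|n] /=. Qed.

Lemma rev_exact d :
  injective (g 0) -> (forall j, (j.+1 < d)%N -> exact_at (g j) (g j.+1)) ->
  forall n, exact_at (rev_map g d n.+1) (rev_map g d n).
Proof.
move=> gI; elim: d => [|d IHd] ex n.
  move=> y; split=> _; last by [].
  by exists 0; rewrite linear0; apply/esym; exact: zero_is_zero.
case: n => [|n]; last by apply: IHd => j jd; apply: ex; exact: ltnW.
case: d => [|d] in ex IHd *; last exact: ex.
move=> y; split=> [/= gy|[x <-] /=]; last by rewrite linear0.
by exists 0; apply: gI; rewrite gy !linear0.
Qed.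

(** Exactness of Hom(E, N) at E_j; no differential enters E_0. *)
Definition extends N j : Prop := forall h : {linear E j -> N},
  match j return {linear E j -> N} -> Prop with
  | 0 => fun=> True
  | j'.+1 => fun h => forall x, h (g j' x) = 0
  end h -> exists h' : {linear E j.+1 -> N}, forall x, h x = h' (g j x).

Lemma rev_hom_exact d i N :
  (i < d)%N -> extends N (d - i.+1) -> hom_complex_exact (rev_map g d) N i.+1.
Proof.
elim: i d => [|i IHi] [|d] // id.
  rewrite subSS subn0 => ext h hg; apply: ext.
  by case: d => [|d] in id h hg * => // x; exact: hg.
by rewrite subSS => ext; apply: IHi ext.
Qed.

End Reverse.

(** ** Truncating a complex at a cokernel *)

(** The complex E_0 -> ... -> E_(d-1) -> T -> 0 -> ... *)
Fixpoint trunc_obj (E : nat -> fgmod R) T d n : fgmod R :=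
  match d, n with
  | 0, 0 => T
  | 0, _.+1 => zero_mod R
  | d'.+1, 0 => E 0%N
  | d'.+1, n'.+1 => trunc_obj (fun i => E i.+1) T d' n'
  end.

Fixpoint trunc_map (E : nat -> fgmod R) (g : forall i, {linear E i -> E i.+1})
    T d : {linear E d -> T} ->
    forall n, {linear trunc_obj E T d.+1 n -> trunc_obj E T d.+1 n.+1} :=
  match d return {linear E d -> T} ->
    forall n, {linear trunc_obj E T d.+1 n -> trunc_obj E T d.+1 n.+1} with
  | 0 => fun p n => match n return
      {linear trunc_obj E T 1 n -> trunc_obj E T 1 n.+1} with
    | 0 => p | n'.+1 => \0 end
  | d'.+1 => fun p n => match n return
      {linear trunc_obj E T d'.+2 n -> trunc_obj E T d'.+2 n.+1} with
    | 0 => g 0%N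
    | n'.+1 => @trunc_map (fun i => E i.+1) (fun i => g i.+1) T d' p n' end
  end.

Lemma trunc_exact (E : nat -> fgmod R) (g : forall i, {linear E i -> E i.+1})
    T d (p : {linear E d -> T}) :
  surjective p ->
  (forall j, (j.+1 < d)%N -> exact_at (g j) (g j.+1)) ->
  match d return {linear E d -> T} -> Prop with
  | 0 => fun=> True | d'.+1 => fun p => exact_at (g d') p end p ->
  forall n, exact_at (trunc_map g p n) (trunc_map g p n.+1).
Proof.
elim: d => [|d IHd] in E g p *.
  move=> pS _ _ [|[|n]] y; split=> //= _; exists 0;
    by apply/esym; exact: zero_is_zero.
move=> pS ex exp [|n].
  by case: d => [|d] in p {pS} ex exp IHd * => //; exact: ex.
apply: (IHd _ (fun i => g i.+1) p) => //; last first.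
  by case: d => [|d] in p exp {pS ex IHd} *.
by move=> j jd; apply: ex.
Qed.

Lemma trunc_obj_zero E T d n : (d < n)%N -> is_zero (trunc_obj E T d n).
Proof.
elim: d E n => [|d IHd] E [|n] //= dn; first exact: zero_is_zero.
exact: IHd.
Qed.

Lemma trunc_obj_all (S : fgmod R -> Prop) (E : nat -> fgmod R) T d n :
  (forall j, S (E j)) -> S T -> (n <= d)%N -> S (trunc_obj E T d n).
Proof.
move=> SE ST; elim: d E SE n => [|d IHd] E SE [|n] //= nd.
by apply: IHd => // j.
Qed.

(** ** Maps between resolutions, from the top down *)

Lemma update_family (T : nat -> Type) (s : forall n, T n) n (c : T n) :
  exists s' : forall n, T n, s' n = c /\ forall j, j != n -> s' j = s j.
Proof.
exists (fun j => match n =P j with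
  | ReflectT e => eq_rect n T c j e | ReflectF _ => s j end); split.
  by case: eqP => // e; rewrite (eq_axiomK e).
by move=> j; case: eqP => // e /eqP nj; case: nj; exact/esym.
Qed.

(** A cocycle F_d -> R_d lifts to a chain map as soon as the Ext groups met on
    the way down vanish: composing with the differential of R gives a cocycle
    F_(n+1) -> R_n, which is a coboundary. *)
Lemma downward_lift Y W (F : nat -> fgmod R) e p (Q : nat -> fgmod R) q r d
    (c : {linear F d -> Q d}) :
  @projective_resolution R Y F e p -> @projective_resolution R W Q q r ->
  (forall n, (n < d)%N -> hom_complex_exact p (Q n) n.+1) ->
  (forall x, c (p d x) = 0) ->
  exists (f : {linear Y -> W}) (phi : forall n, {linear F n -> Q n}),
  [/\ phi d = c, forall x, q (phi 0%N x) = f (e x)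
    & forall n x, (n < d)%N -> r n (phi n.+1 x) = phi n (p n x)].
Proof.
move=> [[eS exe exp] pF] [[qS exq exr] pQ] hex cp.
pose low n (h : {linear F n -> Q n}) := match n return
    {linear F n -> Q n} -> Prop with
  | 0 => fun h => forall x, q (h (p 0%N x)) = 0
  | m.+1 => fun h => forall x, r m (h (p m.+1 x)) = 0 end h.
suff {c cp} gen n (c : {linear F n -> Q n}) : (n <= d)%N -> low n c ->
    exists (f : {linear Y -> W}) (phi : forall n, {linear F n -> Q n}),
  [/\ phi n = c, forall x, q (phi 0%N x) = f (e x)
    & forall j x, (j < n)%N -> r j (phi j.+1 x) = phi j (p j x)].
  by apply: gen => //; case: d c cp {hex} => [|d] c cp x; rewrite cp linear0.
elim: n c => [|n IHn] c nd lowc.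
  have [|f fE] := factor_surj (h := q \o c) eS.
    by move=> x /exe[y <-]; exact: lowc.
  have [phi [phi0 _]] := update_family (fun n => \0 : {linear F n -> Q n}) c.
  by exists f, phi; split=> // x; rewrite phi0 fE.
have [x|g gE] := hex n nd (r n \o c); first exact: lowc.
have [|f [phi [phin phi0 phiS]]] := IHn g (ltnW nd).
  by case: n c nd lowc g gE {IHn} => [|n] c nd lowc g gE x /=;
    rewrite -gE /= ?(exact_comp exq) ?(exact_comp (exr n)).
have [phi' [phi'n phi'E]] := update_family phi c.
exists f, phi'; split=> // [x|j x]; first by rewrite phi'E.
rewrite ltnS leq_eqVlt => /orP[/eqP e1|jn].
  subst j; by rewrite phi'n phi'E ?neq_ltn ?leqnn // phin -gE.
by rewrite !phi'E ?phiS // neq_ltn ?ltnS ?jn // (ltnW jn).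
Qed.

(** A chain endomorphism vanishing in degree d is null-homotopic up to a map
    through the projective module in degree 0, by the same descent. *)
Lemma downward_null W (Q : nat -> fgmod R) q r d (pi : {linear W -> W})
    (eps : forall n, {linear Q n -> Q n}) :
  @projective_resolution R W Q q r ->
  (forall x, q (eps 0%N x) = pi (q x)) ->
  (forall n x, r n (eps n.+1 x) = eps n (r n x)) ->
  (forall x, eps d.+1 x = 0) ->
  (forall n, (n < d)%N -> hom_complex_exact r (Q n.+1) n.+1) ->
  exists s : {linear W -> Q 0%N}, forall w, pi w = q (s w).
Proof.
move=> [[qS exq exr] pQ] eps0 epsS epsd hex.
suff gen n (t : {linear Q n -> Q n.+1}) : (n <= d)%N ->
    (forall x, eps n (r n x) = r n (t (r n x))) ->
    exists s : {linear W -> Q 0%N}, forall w, pi w = q (s w).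
  by apply: (gen d \0) => // x; rewrite -epsS epsd !linear0.
elim: n t => [|n IHn] t nd ht.
  have [|s sE] := factor_surj (h := eps 0%N \- (r 0%N \o t)) qS.
    by move=> x /exq[y <-]; rewrite /= ht subrr.
  exists s => w; have [x <-] := qS w.
  by rewrite sE /= linearB /= (exact_comp exq) subr0 eps0.
have [|t' t'E] := hex n nd (eps n.+1 \- (r n.+1 \o t)).
  by move=> x; rewrite /= ht subrr.
apply: (IHn t' (ltnW nd)) => x.
by rewrite -t'E /= linearB /= (exact_comp (exr n)) subr0 epsS.
Qed.

(** ** Mapping cones *)

Definition cone_map X X' Z Z' (a : {linear X -> X'}) (phi : {linear X -> Z'})
    (z : {linear Z -> Z'}) : {linear dsum X Z -> dsum X' Z'} :=
  pairing (\- (a \o out1 X Z)) ((phi \o out1 X Z) \+ (z \o out2 X Z)).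

Lemma cone_mapE X X' Z Z' (a : {linear X -> X'}) (phi : {linear X -> Z'})
    (z : {linear Z -> Z'}) x y : cone_map a phi z (x, y) = (- a x, phi x + z y).
Proof. by rewrite /cone_map pairingE. Qed.

Section Cone.
Variables (X2 X1 X0 Z2 Z1 Z0 : fgmod R).
Variables (a1 : {linear X2 -> X1}) (a0 : {linear X1 -> X0}).
Variables (z1 : {linear Z2 -> Z1}) (z0 : {linear Z1 -> Z0}).
Variables (phi1 : {linear X2 -> Z1}) (phi0 : {linear X1 -> Z0}).
Hypotheses (exa : exact_at a1 a0) (exz : exact_at z1 z0).
Hypothesis comm : forall x, z0 (phi1 x) = phi0 (a1 x).

Lemma cone_exact : exact_at (cone_map a1 phi1 z1) (cone_map a0 phi0 z0).
Proof.
apply: exact_sub => [[x y]|[x y]]; rewrite !cone_mapE.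
  have -> : a0 (- a1 x) = 0 by rewrite linearN (exact_comp exa) oppr0.
  have -> : phi0 (- a1 x) = - z0 (phi1 x) by rewrite linearN comm.
  by rewrite linearD (exact_comp exz) addr0 addNr oppr0.
case=> /eqP; rewrite oppr_eq0 => /eqP/exa[x' x'E] yE.
have /exz[y' y'E] : z0 (y + phi1 x') = 0.
  by rewrite linearD comm x'E addrC.
exists (- x', y'); rewrite cone_mapE !linearN opprK x'E y'E.
by rewrite addrC addrK.
Qed.

(** Maps out of the cone: a cocycle (alpha, beta) is a coboundary once beta is
    one on the Z side, and then the corrected alpha is one on the X side. *)
Lemma cone_hom N :
  (forall b : {linear Z1 -> N}, (forall y, b (z1 y) = 0) ->
     (exists a : {linear X1 -> N}, forall x, b (phi1 x) = a (a1 x)) ->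
     exists c : {linear Z0 -> N}, forall y, b y = c (z0 y)) ->
  (forall a : {linear X1 -> N}, (forall x, a (a1 x) = 0) ->
     exists (c : {linear Z0 -> N}) (b : {linear X0 -> N}),
       (forall y, c (z0 y) = 0) /\ forall x, a x = c (phi0 x) + b (a0 x)) ->
  forall h : {linear dsum X1 Z1 -> N},
  (forall u, h (cone_map a1 phi1 z1 u) = 0) ->
  exists g : {linear dsum X0 Z0 -> N},
    forall u, h u = g (cone_map a0 phi0 z0 u).
Proof.
move=> HZ HX h h0; 
pose a : {linear X1 -> N} := h \o in1 X1 Z1.
pose b : {linear Z1 -> N} := h \o in2 X1 Z1.
have hE x y : h (x, y) = a x + b y.
  by rewrite [(x, y)]dsum_split linearD.
have [||c cE] := HZ b.
- move=> y; have := h0 (0, y); rewrite cone_mapE hE !linear0.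
  by rewrite !add0r.
- exists a => x; have := h0 (x, 0); rewrite cone_mapE hE linear0 addr0 linearN.
  by move/eqP; rewrite addrC subr_eq0 => /eqP.
have [|c' [b' [c'0 aE]]] := HX (a \- (c \o phi0)).
  move=> x; rewrite /= -comm -cE.
  have := h0 (x, 0); rewrite cone_mapE hE linear0 addr0 linearN.
  by move/eqP; rewrite addrC subr_eq0 /= => /eqP->; rewrite subrr.
exists (copair (\- b') (c \+ c')) => -[x y].
rewrite cone_mapE copairE hE /= linearN opprK !linearD c'0 addr0.
have /= /(canRL (subrK _)) -> := aE x.
rewrite -cE [c' _ + _]addrC -!addrA; congr (_ + _).
by rewrite addrC -addrA.
Qed.

End Cone.

(** ** Projectivity from the vanishing of Ext *)

(** If Ext^i(L, M) = 0 for 1 <= i <= d then the syzygy of L lies in M by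
    dimension shift, so the extension defining it splits. *)
Lemma projective_criterion d (M : fgmod R -> Prop) L C e f :
  (1 <= d)%N -> cluster_tilting d M -> @projective_resolution R L C e f ->
  (forall N n, M N -> (n < d)%N -> hom_complex_exact f N n.+1) ->
  M L /\ projective L.
Proof.
move=> d1 [_ _ Mleft _] [[eS exe exf] pC] hex; split.
  apply/Mleft => N MN [//|n] nd; exists C, e, f; split=> //.
  by apply: hex => //; exact: ltnW.
have [K [s [i [sS iI is_]]]] := image_exists (f 0).
have MK : M K.
  apply/Mleft => N MN [//|n] nd.
  exists (fun n => C n.+1), s, (fun n => f n.+1); split.
  - split=> // y; split=> [sy|[x <-]].
      by apply/exf; rewrite -is_ sy linear0.
    by apply: iI; rewrite is_ (exact_comp (exf 0)) linear0.
  - by move=> j; exact: pC.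
  - exact: (hex N n.+1 MN nd).
have [|g gE] := hex K 0 MK d1 s.
  by move=> x; apply: iI; rewrite is_ (exact_comp (exf 0)) linear0.
have gi : cancel i g.
  by move=> z; have [x <-] := sS z; rewrite is_ gE.
have [|t tE] := factor_surj (h := idfun \- (i \o g)) eS.
  by move=> x /exe[y <-]; rewrite /= -is_ gi subrr.
apply: (@projective_retract _ L (C 0) t e) (pC 0) => l.
have [x <-] := eS l; rewrite tE /= linearB /=.
by have [y <-] := sS (g x); rewrite is_ (exact_comp exe) subr0.
Qed.

End Complexes.

(** * Simple projective modules *)

Section Simple.
Variable R : nzRingType.
Implicit Types X Y Z T P Q : fgmod R.

Lemma simple_nonzero P : simple_mod P -> exists x : P, x <> 0.
Proof. by move=> [/existsNP]. Qed.

Lemma simple_surj P X (h : {linear X -> P}) x :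
  simple_mod P -> h x <> 0 -> surjective h.
Proof.
move=> [_ sP] hx; have [K [s [i [sS iI is_]]]] := image_exists h.
have [K0|iS] := sP K i iI; first by case: hx; rewrite -is_ (K0 (s x)) linear0.
by move=> y; have [z <-] := iS y; have [w <-] := sS z; exists w; rewrite is_.
Qed.

(** If h kills y, it kills the submodule generated by y, which is all of P
    unless y = 0. *)
Lemma simple_inj P (Y : lmodType R) (h : {linear P -> Y}) x :
  simple_mod P -> h x <> 0 -> injective h.
Proof.
move=> sP hx; apply: linear_inj0 => y hy; apply: contrapT => y0.
have [|a ay] := simple_surj (h := scalemap y) (x := (1 : R)) sP _ x.
  by rewrite /= scale1r.
by case: hx; rewrite -ay linearZ /= hy scaler0.
Qed.

Lemma simple_split P X (h : {linear X -> P}) x :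
  simple_mod P -> projective P -> h x <> 0 ->
  exists s : {linear P -> X}, cancel s h.
Proof.
move=> sP pP hx; have [s sE] := pP _ _ h idfun (simple_surj sP hx).
by exists s.
Qed.

Lemma not_no_hom (X Y : lmodType R) :
  ~ no_hom X Y -> exists (h : {linear X -> Y}) x, h x <> 0.
Proof. by move=> /existsNP[h /existsNP[x hx]]; exists h, x. Qed.

(** X is a summand of a sum of copies of A = P + Q, and its components in P
    vanish. *)
Lemma in_add_complement P Q X :
  iso (regular_mod R) (dsum P Q) -> projective X -> no_hom X P -> in_add Q X.
Proof.
move=> /iso_inverse[a [b [ab ba]]] pX X0.
have [l hl] := projective_in_add pX.
exists (map (fun q : ({linear X -> regular_mod R} *
                      {linear regular_mod R -> X})%type =>
  (out2 P Q \o (a \o q.1) : {linear X -> Q},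
   q.2 \o (b \o in2 P Q) : {linear Q -> X})) l) => x.
rewrite big_map {1}(hl x); apply: eq_bigr => q _ /=.
have := X0 (out1 P Q \o (a \o q.1)) x; rewrite /= => x0.
rewrite -[in LHS](ab (q.1 x)); congr (q.2 (b _)).
by move: x0; case: (a (q.1 x)) => u v /= ->.
Qed.

Lemma dsums_remove n (F : 'I_n -> fgmod R) (l : seq 'I_n) i :
  uniq l -> i \in l ->
  iso (dsums [seq F j | j <- l])
      (dsum (F i) (dsums [seq F j | j <- l & j != i])).
Proof.
elim: l => //= j l IHl /andP[jl ul]; rewrite inE.
have [->|ij] /= := eqVneq i j => il.
  have -> : [seq j0 <- l | j0 != j] = l.
    by apply/all_filterP/allP => z zl; apply: contraNneq jl => <-.
  exact: iso_refl.
apply: iso_trans (iso_dsum (iso_refl _) (IHl ul il)) _.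
apply: iso_trans (iso_dsumA _ _ _) _.
apply: iso_trans (iso_dsum (iso_dsumC _ _) (iso_refl _)) _.
exact/iso_sym/iso_dsumA.
Qed.

Lemma no_hom_dsums (S : Type) (F : S -> fgmod R) (l : seq S) P :
  foldr (fun j p => no_hom (F j) P /\ p) True l ->
  no_hom (dsums [seq F j | j <- l]) P.
Proof.
elim: l => [_ h x|j l IHl [hj /IHl hl]].
  by rewrite (zero_is_zero x) linear0.
exact: no_hom_dsum.
Qed.

Lemma in_add_dsums n (F : 'I_n -> fgmod R) (l : seq 'I_n) i :
  i \in l -> in_add (dsums [seq F j | j <- l]) (F i).
Proof.
elim: l => //= j l IHl; rewrite inE => /orP[/eqP->|/IHl il].
  exact/in_add_dsuml/in_add_refl.
by apply: through_in_add il; exact/in_add_dsumr/in_add_refl.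
Qed.

Lemma indecomposable_split P X (s : {linear P -> X}) (r : {linear X -> P}) :
  cancel s r -> ~ is_zero P -> indecomposable X -> iso P X.
Proof.
move=> sr P0 [_ iX]; have [K [_ [_ [_ _ _ isoK]]]] := split_complement sr.
have [|//|K0] := iX P K; first exact: iso_sym.
exact: iso_trans (iso_sym (iso_dsum0 _ K0)) isoK.
Qed.

(** Some indecomposable summand F_i0 of A maps onto P, hence is isomorphic to P,
    and no other one does since A is basic. The sum of the others and Q are then
    both the kernel of a projection of A onto P. *)
Lemma simple_basic_complement P Q :
  basic (regular_mod R) -> simple_mod P -> projective P ->
  iso (regular_mod R) (dsum P Q) ->
  exists n (F : 'I_n -> fgmod R) (i0 : 'I_n),
  [/\ forall i, indecomposable (F i), forall i j, iso (F i) (F j) -> i = j,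
      forall i, projective (F i), iso P (F i0)
    & iso Q (dsums [seq F j | j <- enum 'I_n & j != i0])] /\
  no_hom Q P.
Proof.
move=> [n [F [isoF indF injF]]] sP pP isoA.
have projF i : projective (F i).
  apply: projective_of_in_add (@projective_regular R) _.
  have [a [b [ab ba]]] := iso_inverse (iso_sym isoF).
  apply: through_in_add (in_add_retract ab (in_add_refl _)) _.
  by apply: in_add_dsums; rewrite mem_enum.
have P0 : ~ is_zero P by case: sP.
have PF i : ~ no_hom (F i) P -> iso P (F i).
  move=> /not_no_hom[h [x hx]]; have [s sh] := simple_split sP pP hx.
  exact: indecomposable_split sh P0 (indF i).
pose D := dsums [seq F i | i <- enum 'I_n].
have isoD : iso D (dsum P Q) := iso_trans (iso_sym isoF) isoA.
have [i0 Fi0] : exists i, ~ no_hom (F i) P.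
  apply: contrapT => /forallNP noF; case: P0 => p.
  have [a [b [ab ba]]] := iso_inverse isoD.
  have noD : no_hom D P.
    apply: no_hom_dsums; elim: (enum _) => //= j l IHl.
    by split=> //; apply: contrapT => /noF.
  by have /= := noD (out1 P Q \o a) (b (p, 0)); rewrite ba.
have isoP := PF i0 Fi0.
exists n, F, i0; pose G := dsums [seq F j | j <- enum 'I_n & j != i0].
have noG : no_hom G P.
  apply: no_hom_dsums; elim: (enum _) => //= j l IHl.
  case: eqP => //= ji; split=> //; apply: contrapT => /PF isoPj.
  by apply: ji; apply: injF; apply: iso_trans (iso_sym isoPj) isoP.
suff isoQ : iso Q G.
  split; first by split.
  have [a [b [ab ba]]] := iso_inverse isoQ.
  exact: no_hom_addl (in_add_retract ab (in_add_refl _)) noG.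
have isoG : iso (dsum P G) (dsum P Q).
  apply: iso_trans isoD; apply: iso_sym.
  apply: iso_trans (dsums_remove (i := i0) F (enum_uniq _) _) _.
    by rewrite mem_enum.
  exact: iso_dsum (iso_sym isoP) (iso_refl _).
have [a [b [ab ba]]] := iso_inverse isoG.
pose t : {linear P -> P} := out1 P Q \o (a \o in1 P G).
have a1 p y : (a (p, y)).1 = t p.
  rewrite [(p, y)]dsum_split linearD /=.
  by have /= -> := noG (out1 P Q \o (a \o in2 P G)) y; rewrite addr0.
have tI : injective t.
  have [p p0] := simple_nonzero sP.
  have : t (b (p, 0)).1 <> 0.
    by rewrite -(a1 _ (b (p, 0)).2) -surjective_pairing ba.
  exact: simple_inj sP.
apply: (@iso_of_cancel _ _ _ (out2 P G \o (b \o in2 P Q))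
  (out2 P Q \o (a \o in2 P G))) => [q|y] /=.
  have b1 : (b (0, q)).1 = 0.
    by apply: tI; rewrite -(a1 _ (b (0, q)).2) -surjective_pairing ba linear0.
  have -> : (0, (b (0, q)).2) = b (0, q) by rewrite [RHS]surjective_pairing b1.
  by rewrite ba.
have -> : (0, (a (0, y)).2) = a (0, y).
  by rewrite [RHS]surjective_pairing a1 linear0.
by rewrite ab.
Qed.

End Simple.

(** * The minimal injective coresolution of a simple projective module *)

Section Essential.
Variable R : nzRingType.
Implicit Types X Y Z P I K : fgmod R.

(** If v o h is nonzero it is injective, so im h avoids im u, which is
    essential. *)
Lemma simple_essential P X I (Y : lmodType R) (u : {linear X -> I})
    (v : {linear I -> Y}) (h : {linear P -> I}) :
  simple_mod P -> essential_image u -> (forall x, v (u x) = 0) ->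
  forall x, v (h x) = 0.
Proof.
move=> sP ess vu x; apply: contrapT => vhx.
have vhI : injective (v \o h) by exact: (simple_inj (h := v \o h) sP vhx).
have hI : injective h by exact: inj_compr vhI.
case: sP => P0 _; case: P0; apply: ess hI _ => y z yz.
have -> : z = 0 by apply: vhI; rewrite /= -yz vu !linear0.
by rewrite linear0.
Qed.

(** The image of t meets the image of u trivially. *)
Lemma idempotent_essential X I (u : {linear X -> I}) (t : {linear I -> I}) :
  essential_image u -> (forall x, t (t x) = t x) ->
  (forall x, t (u x) = u x -> u x = 0) -> forall x, t x = 0.
Proof.
move=> ess tt tu x; have [K [s [i [sS iI is_]]]] := image_exists t.
suff K0 : is_zero K by rewrite -is_ (K0 (s x)) linear0.
apply: ess iI _ => y z yz; have [w wz] := sS z.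
by rewrite -yz; apply: tu; rewrite yz -wz is_ tt.
Qed.

End Essential.

Section MinimalCoresolution.
Variables (k : fieldType) (A : falgType k) (P Q : fgmod A^c).
Hypotheses (sP : simple_mod P) (pP : projective P) (niP : ~ injective_mod P).
Hypothesis isoA : iso (regular_mod A^c) (dsum P Q).

Lemma no_hom_DA : no_hom (DA A) P.
Proof.
apply: contrapT => /not_no_hom[h [x hx]].
have [s sh] := simple_split (X := DA A) sP pP hx.
exact/niP/(injective_retract sh)/DA_injective.
Qed.

Variables (I : nat -> fgmod A^c) (e : {linear P -> I 0%N}).
Variable (f : forall i, {linear I i -> I i.+1}).
Hypothesis min : min_injective_coresolution e f.

Let iI j : injective_mod (I j).
Proof. by case: min. Qed.

Let aI j : in_add (DA A) (I j) := injective_in_add (@iI j).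

Definition nu_obj j : fgmod A^c := FgMod (nu_fg (@aI j)).
Definition nu_diff j : {linear nu_obj j -> nu_obj j.+1} := nu_inv_map (f j).

Lemma nu_projective j : projective (nu_obj j).
Proof.
exact: (projective_of_in_add (X := nu_obj j) (@projective_regular _)
  (nu_in_add (@aI j))).
Qed.

(** A map P -> I_(j+1) lands in the image of the essential map f_j, so it lifts
    to P -> I_j, whose image is killed by f_j for the same reason. *)
Lemma no_hom_injective_term j : no_hom P (I j.+1).
Proof.
case: min => -[eI ex0 ex] _ esse essf h x.
have fh : forall x, f j.+1 (h x) = 0.
  by apply: simple_essential sP (essf j) _; exact: exact_comp (ex j).
have [h' h'E] := projective_lift pP (ex j) fh.
rewrite -h'E; case: j h h' h'E {fh} => [|j] h h' h'E.
  by apply: simple_essential sP esse _ x; exact: exact_comp ex0.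
by apply: simple_essential sP (essf j) _ x; exact: exact_comp (ex j).
Qed.

Lemma nu_map_zero (X Y : fgmod A^c) (q : nu_inv X) :
  nu_inv_map (\0 : {linear X -> Y}) q = 0.
Proof. exact: linear_ext. Qed.

Lemma no_hom_nu_obj j : no_hom (nu_obj j.+1) P.
Proof.
move=> h q; have a0 := in_add_zero (DA A) (@zero_is_zero A^c).
have [| |g gE] := @nu_hom_exact _ _ P _ _ _ (\0 : {linear zero_mod _ -> I j.+1})
  (\0 : {linear I j.+1 -> zero_mod _}) a0 (@aI j.+1) a0 _ h.
- by move=> phi _; exists \0 => x; rewrite no_hom_injective_term linear0.
- by move=> q'; rewrite nu_map_zero linear0.
- by rewrite gE nu_map_zero linear0.
Qed.

Lemma nu_obj_in_add j : in_add Q (nu_obj j.+1).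
Proof. exact: in_add_complement isoA (@nu_projective _) (@no_hom_nu_obj _). Qed.

(** P is a summand of nu^- I_0. The corresponding idempotent comes from one of
    I_0; as P is simple and essential in I_0, it is either contained in the
    image or in the kernel of that idempotent, which is therefore trivial. *)
Lemma nu_obj0_iso : iso (nu_obj 0) P.
Proof.
case: min => -[eI ex0 ex] _ esse essf.
have [x0 x0P] := simple_nonzero sP.
have [h [q hq]] : exists (h : {linear nu_obj 0 -> P}) q, h q <> 0.
  apply: not_no_hom => /(nu_no_hom (@aI 0))/(_ e x0) ex0'.
  by apply: x0P; apply: eI; rewrite ex0' linear0.
have [s sh] := simple_split sP pP hq.
have [t tE] := @nu_full _ _ (I 0) (I 0) (s \o h) (@aI 0).
have tt x : t (t x) = t x.
  apply: (@nu_faithful _ _ _ _ (t \o t) t (@aI 0)) => {}x.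
  have -> : nu_inv_map (t \o t) x = nu_inv_map t (nu_inv_map t x).
    exact: linear_ext.
  by rewrite -!tE /= sh.
have [te|/existsNP[x te]] := pselect (forall x, t (e x) = 0).
  have t0 x : t x = 0.
    by apply: idempotent_essential esse tt _ x => y; rewrite te => <-.
  case: hq; rewrite -(sh (h q)); have /= -> := tE q.
  have -> : nu_inv_map t q = 0 by apply: linear_ext => y /=; exact: t0.
  by rewrite linear0.
have teI : injective (t \o e) by exact: (simple_inj (h := t \o e) sP te).
have t1 y : t y = y.
  have u0 := @idempotent_essential _ _ _ e (idfun \- t) esse.
  apply/esym/eqP; rewrite -subr_eq0; apply/eqP/u0 => z /=.
    by rewrite linearB /= tt subrr subr0.
  rewrite -[RHS]subr0 => /addrI/oppr_inj ty.
  have -> : z = 0 by apply: teI; rewrite /= ty !linear0.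
  by rewrite linear0.
apply: (@iso_of_cancel _ (nu_obj 0) P h s _ sh) => q'.
have /= -> := tE q'; apply: linear_ext => y /=; exact: t1.
Qed.

Lemma nu_diff0_inj : injective (nu_diff 0).
Proof.
case: min => -[eI ex0 ex] _ esse essf.
apply: linear_inj0 => q fq.
have fq' (x : dual A) : f 0 ((q : {linear dual A -> I 0}) x) = 0.
  exact: (congr1 (fun q : nu_inv (I 1) => (q : {linear dual A -> I 1}) x) fq).
have [|c cE] := factor_inj (h := (q : {linear DA A -> I 0})) eI.
  by move=> x; apply/ex0; exact: fq'.
by apply: linear_ext => x; rewrite -cE no_hom_DA linear0.
Qed.

Lemma nu_diff_exact b : ext_zero b.+1 (DA A) P ->
  exact_at (nu_diff b) (nu_diff b.+1).
Proof.
case: min => cores _ _ _ extP; have [_ _ ex] := cores.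
apply: exact_sub => [q|q fq].
  by apply: linear_ext => x /=; rewrite (exact_comp (ex b)).
have [x|g gE] := hom_coresolution_exact cores iI extP
    (h := (q : {linear DA A -> I b.+1})).
  exact: (congr1 (fun q : nu_inv (I b.+2) =>
    (q : {linear dual A -> I b.+2}) x) fq).
by exists (g : nu_inv (I b)); apply: linear_ext => x /=; rewrite gE.
Qed.

Lemma nu_extends0 (N : fgmod A^c) : no_hom N P -> extends nu_diff N 0.
Proof.
case: min => -[eI ex0 ex] _ _ _ N0 h _.
have a0 := in_add_zero (DA A) (@zero_is_zero A^c).
have [||g gE] := @nu_hom_exact _ _ N _ _ _ (\0 : {linear zero_mod _ -> I 0})
  (f 0) a0 (@aI 0) (@aI 1) _ h; last by exists g.
- move=> phi fphi; have [|c cE] := factor_inj (h := phi) eI.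
    by move=> x; apply/ex0.
  by exists \0 => x; rewrite -cE N0 !linear0.
- by move=> q'; rewrite nu_map_zero linear0.
Qed.

Lemma nu_extendsS (N : fgmod A^c) b :
  ext_zero b.+1 N P -> extends nu_diff N b.+1.
Proof.
case: min => cores _ _ _ extP h hg.
have [phi fphi||g gE] := @nu_hom_exact _ _ N _ _ _ (f b) (f b.+1)
  (@aI b) (@aI b.+1) (@aI b.+2) _ h; last by exists g.
  by have [c cE] := hom_coresolution_exact cores iI extP fphi; exists c.
exact: hg.
Qed.

(** X is a quotient of copies of A = P + Q, and each map P -> X extends along
    P = nu^- I_0 -> nu^- I_1 to a summand of a sum of copies of Q. *)
Lemma Fac_of_no_hom (X : fgmod A^c) : no_hom X P -> Fac Q X.
Proof.
move=> X0; have [a [b [ab ba]]] := iso_inverse isoA.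
have [u [v [uv vu]]] := iso_inverse nu_obj0_iso.
apply: Fac_of_sums => x.
have [h hE] :=
  nu_extends0 X0 (h := scalemap x \o (b \o (in1 P Q \o u))) Logic.I.
have [l hl] := nu_obj_in_add 0.
pose y := a (1 : A^c).
exists ((y.2, scalemap x \o (b \o in2 P Q) : {linear Q -> X}) ::
  map (fun q : ({linear nu_obj 1 -> Q} * {linear Q -> nu_obj 1})%type =>
    (q.1 (nu_diff 0 (v y.1)), h \o q.2 : {linear Q -> X})) l).
rewrite big_cons big_map /= -linear_sum -hl -hE /= vu addrC -scalerDl.
by rewrite -linearD -dsum_split ab scale1r.
Qed.

Lemma no_hom_cokernel j (X : fgmod A^c) (p : {linear nu_obj j.+1 -> X}) :
  surjective p -> no_hom X P.
Proof. by move=> pS; apply: no_hom_surj pS (@no_hom_nu_obj j). Qed.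

(** A projective quotient of the cokernel of nu^-(f_j) splits off nu^- I_(j+1)
    and misses the image of f_j, which is essential. *)
Lemma cokernel_no_projective_summand j (W X : fgmod A^c)
    (p : {linear nu_obj j.+1 -> W})
    (s : {linear X -> W}) (r : {linear W -> X}) :
  surjective p -> exact_at (nu_diff j) p -> cancel s r -> projective X ->
  is_zero X.
Proof.
case: min => -[eI ex0 ex] _ esse essf pS exp sr pX.
have rpS : surjective (r \o p).
  by move=> x; have [w wE] := pS (s x); exists w; rewrite /= wE sr.
have [z zE] := pX _ _ (r \o p) idfun rpS.
pose eps : {linear nu_obj j.+1 -> nu_obj j.+1} := z \o (r \o p).
have [t tE] := @nu_full _ _ (I j.+1) (I j.+1) eps (@aI j.+1).
have tt x : t (t x) = t x.
  apply: (@nu_faithful _ _ _ _ (t \o t) t (@aI j.+1)) => {}x.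
  have -> : nu_inv_map (t \o t) x = nu_inv_map t (nu_inv_map t x).
    exact: linear_ext.
  by rewrite -!tE /eps /= [r _](zE _).
have tf x : t (f j x) = 0.
  apply: (@nu_faithful _ _ _ _ (t \o f j) \0 (@aI j)) => {}x.
  have -> : nu_inv_map (t \o f j) x = nu_inv_map t (nu_inv_map (f j) x).
    exact: linear_ext.
  rewrite -tE nu_map_zero /eps /=.
  have -> : p (nu_inv_map (f j) x) = 0 by apply/exp; exists x.
  by rewrite !linear0.
have t0 : forall x, t x = 0.
  by apply: idempotent_essential (essf j) tt _ => x; rewrite tf => <-.
move=> x; have rpz : r (p (z x)) = x by exact: zE.
have zx : z x = 0.
  have := tE (z x); rewrite /eps /= rpz => ->.
  by apply: linear_ext => y /=; exact: t0.
by rewrite -rpz zx !linear0.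
Qed.

End MinimalCoresolution.

(** * Splitting off the simple projective summands *)

Section Decomposition.
Variables (k : fieldType) (A : falgType k) (P : fgmod A^c).
Hypotheses (sP : simple_mod P) (pP : projective P).

(** Every map of a finite spanning family of Hom(X, P) is either zero on what is
    left of X or splits off one more copy of P. *)
Lemma simple_decomposition (X : fgmod A^c) :
  exists (X' : fgmod A^c) m
    (a : {linear X -> dsum X' (dsums (nseq m P))})
    (b : {linear dsum X' (dsums (nseq m P)) -> X}),
  [/\ cancel a b, cancel b a & no_hom X' P].
Proof.
have [n [hs [_ span]]] := @hom_span _ _ X P (fun=> True).
suff [X' [m [a [b [ab ba hb]]]]] : exists (X' : fgmod A^c) m
    (a : {linear X -> dsum X' (dsums (nseq m P))})
    (b : {linear dsum X' (dsums (nseq m P)) -> X}),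
  [/\ cancel a b, cancel b a & forall i x, hs i (b (x, 0)) = 0].
  exists X', m, a, b; split=> // h x.
  have [c cE] := span (h \o (out1 _ _ \o a)) I.
  have := cE (b (x, 0)); rewrite /= ba /= => ->.
  by rewrite big1 // => i _; rewrite hb /kscale scaler0.
elim: n hs {span} => [|n IHn] hs.
  exists X, 0, (in1 _ _), (out1 _ _); split=> // [[x y]|[]//].
  by congr pair; exact/esym/zero_is_zero.
have [X' [m [a [b [ab ba hb]]]]] := IHn (fun i => hs (lift ord0 i)).
have lift_case (T : Type) (j : T -> X) :
    (forall x, hs ord0 (j x) = 0) -> (forall i x, hs (lift ord0 i) (j x) = 0) ->
    forall i x, hs i (j x) = 0.
  by move=> h0 h1 i; have [i' ->|->] := unliftP ord0 i.
pose h : {linear X' -> P} := hs ord0 \o (b \o in1 _ _).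
have [h0|/existsNP[x hx]] := pselect (forall x, h x = 0).
  exists X', m, a, b; split=> //.
  exact: (lift_case _ (fun x => b (x, 0))).
have [s sh] := simple_split sP pP hx.
have [K [i [q [hi iq dec _]]]] := split_complement sh.
have qs y : q (s y) = 0.
  apply: (can_inj iq); have := dec (s y); rewrite sh linear0.
  by move/(canRL (addKr _)); rewrite addNr.
have hE y : hs ord0 (b (y, 0)) = h y by [].
exists K, m.+1, (pairing (q \o (out1 _ _ \o a))
  (pairing (h \o (out1 _ _ \o a)) (out2 _ _ \o a))),
  (b \o pairing (copair i (s \o out1 _ _)) (out2 _ _ \o out2 _ _)); split.
- move=> y; rewrite /= hE addrC dec.
  by rewrite -surjective_pairing ab.
- move=> [z [y w]]; rewrite /= ba /= hE.
  by rewrite !linearD iq qs hi sh addr0 add0r.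
- apply: (lift_case _ (fun x => (b \o pairing (copair i (s \o out1 _ _))
    (out2 _ _ \o out2 _ _)) (x, 0))) => [z|j z];
  rewrite /= linear0 addr0 //.
  exact: hi.
Qed.

End Decomposition.

(** * The weak APR tilting module *)

(** The index is shifted: M is (d + 1)-cluster tilting and tau is the cokernel
    tau_(d+1)^- P. *)

Section WeakAPR.
Variables (k : fieldType) (A : falgType k) (d : nat) (M : fgmod A^c -> Prop).
Variables (P Q tau : fgmod A^c).
Hypothesis CT : cluster_tilting d.+1 M.
Hypotheses (sP : simple_mod P) (pP : projective P) (niP : ~ injective_mod P).
Hypotheses (isoA : iso (regular_mod A^c) (dsum P Q)) (QP : no_hom Q P).
Variables (I : nat -> fgmod A^c) (e : {linear P -> I 0%N}).
Variable (f : forall i, {linear I i -> I i.+1}).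
Hypothesis min : min_injective_coresolution e f.

Local Notation E := (nu_obj min).
Local Notation g := (nu_diff min).

Variable p : {linear E d.+1 -> tau}.
Hypotheses (pS : surjective p) (exp : exact_at (g d) p).

Let Msub : subcategory M. Proof. by case: CT. Qed.

Lemma ct_ext N N' n : M N -> M N' -> (n < d)%N -> ext_zero n.+1 N N'.
Proof. by case: CT => _ _ Ml _ MN MN' nd; apply: ((Ml N).1 MN). Qed.

Lemma ct_projective X : projective X -> M X.
Proof.
case: CT => _ _ Ml _ pX; apply/Ml => N _ [//|n] _.
exact: ext_zero_projective.
Qed.

Lemma ct_DA : M (DA A).
Proof.
case: CT => _ _ _ Mr; apply/Mr => N MN [//|n] /= nd.
have [F [eF [pF [res pF' _]]]] := ct_ext MN MN nd.
exists F, eF, pF; split=> //.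
apply: hom_exact_injective; last exact: DA_injective.
by case: res.
Qed.

Let MP : M P := ct_projective pP.

Lemma Q_projective : projective Q.
Proof.
have [a [b [ab ba]]] := iso_inverse isoA.
apply: (@projective_retract _ Q (regular_mod A^c)
  (b \o in2 P Q) (out2 P Q \o a)) => [x|].
  by rewrite /= ba.
exact: projective_regular.
Qed.

(** ** The resolution of tau *)

Local Notation r := (rev_map g d.+1).

Lemma tau_resolution : projective_resolution p r.
Proof.
split; last first.
  move=> n; apply: (@rev_obj_all _ _ (@projective A^c)).
    exact: nu_projective.
  exact/projective_zero/zero_is_zero.
split=> //; apply: rev_exact; first exact: nu_diff0_inj.
by move=> j jd; apply: nu_diff_exact; exact: ct_ext ct_DA MP jd.
Qed.

Lemma tau_hom N n : M N -> (n < d)%N -> hom_complex_exact r N n.+1.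
Proof.
move=> MN nd; apply: rev_hom_exact; first exact: ltnW.
rewrite subSn //; apply: nu_extendsS; apply: ct_ext => //.
by rewrite ltn_subrL (leq_ltn_trans _ nd).
Qed.

Lemma tau_hom_top (N : fgmod A^c) : no_hom N P -> hom_complex_exact r N d.+1.
Proof.
by move=> N0; apply: rev_hom_exact => //; rewrite subnn; exact: nu_extends0.
Qed.

Lemma tau_term_lower n :
  (n <= d)%N -> M (rev_obj E d.+1 n) /\ no_hom (rev_obj E d.+1 n) P.
Proof.
move=> nd.
apply: (@rev_obj_lower _ _ (fun X => M X /\ no_hom X P)) => // -[//|j] _.
by split; [exact/ct_projective/nu_projective | exact: no_hom_nu_obj].
Qed.

Lemma tau_term_top : iso (rev_obj E d.+1 d.+1) P.
Proof. exact: iso_trans (rev_obj_top _ _) (nu_obj0_iso sP pP min). Qed.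

Lemma ct_tau : M tau.
Proof.
case: CT => _ _ Ml _; apply/Ml => N MN [//|n] /= nd.
exact: ext_of_hom_exact tau_resolution (tau_hom MN nd).
Qed.

Lemma no_hom_tau : no_hom tau P.
Proof. exact: (@no_hom_cokernel _ _ _ sP pP _ _ _ min d tau p pS). Qed.

Local Notation Td := (dsum tau Q).

Lemma ct_Td : M Td.
Proof. exact: (sub_dsum Msub ct_tau (ct_projective Q_projective)). Qed.

Lemma no_hom_Td : no_hom Td P.
Proof. exact: (no_hom_dsum no_hom_tau QP). Qed.

Lemma ext_Td (N : fgmod A^c) : no_hom N P -> ext_zero d.+1 Td N.
Proof.
move=> N0; apply: ext_zero_dsum; last exact/ext_zero_projective/Q_projective.
exact: ext_of_hom_exact tau_resolution (tau_hom_top N0).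
Qed.

(** ** Ext-projective objects *)

Section Generator.
Variables (Y : fgmod A^c).
Hypotheses (MY : M Y) (Y0 : no_hom Y P).
Variables (F : nat -> fgmod A^c) (eF : {linear F 0%N -> Y}).
Variable (pF : forall i, {linear F i.+1 -> F i}).
Hypothesis resF : projective_resolution eF pF.
Hypothesis extY : forall N : fgmod A^c,
  M N -> no_hom N P -> hom_complex_exact pF N d.+1.

Lemma Y_hom N n : M N -> (n < d)%N -> hom_complex_exact pF N n.+1.
Proof. by move=> MN nd; apply: hom_exact_of_ext resF (ct_ext _ _ _). Qed.

(** Cocycles F_(d+1) -> P that are linearly independent modulo coboundaries
    over the division ring End(P), gathered into one cocycle with values in
    the top term of a resolution of a sum W of copies of tau. The list is
    processed one cocycle at a time, skipping those that depend on the
    others already chosen. *)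
Lemma universal_cocycle n (cs : 'I_n -> {linear F d.+1 -> P}) :
  (forall i x, cs i (pF d.+1 x) = 0) ->
  exists (W : fgmod A^c) (R : nat -> fgmod A^c) (q : {linear R 0%N -> W})
    (s : forall i, {linear R i.+1 -> R i}) (c : {linear F d.+1 -> R d.+1}),
  ([/\ projective_resolution q s, in_add Td W,
      forall m, (d.+1 < m)%N -> is_zero (R m)
    & forall m, (m <= d)%N -> M (R m) /\ no_hom (R m) P] /\
   [/\ forall N m, M N -> (m < d)%N -> hom_complex_exact s N m.+1
     & forall N : fgmod A^c, no_hom N P -> hom_complex_exact s N d.+1]) /\
  [/\ forall x, c (pF d.+1 x) = 0,
      forall u : {linear R d.+1 -> P},
        (exists a : {linear F d -> P}, forall x, u (c x) = a (pF d x)) ->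
        forall y, u y = 0
    & forall i, exists (u : {linear R d.+1 -> P}) (a : {linear F d -> P}),
        forall x, cs i x = u (c x) + a (pF d x)].
Proof.
elim: n cs => [|n IHn] cs cocs.
  have z0 := @zero_is_zero A^c.
  exists (zero_mod _), (fun=> zero_mod _), \0, (fun=> \0), \0.
  split; first split; first split=> //.
  - split=> [|m]; last exact: projective_zero.
    split=> [y|x|m x]; first by exists 0; exact/esym/z0.
      by split=> // _; exists 0; exact/esym/z0.
    by split=> // _; exists 0; exact/esym/z0.
  - exact: in_add_zero.
  - move=> m _; split; first exact: sub_zero.
    by move=> h x; rewrite (z0 x) linear0.
  - by split=> *; apply: hom_exact_zero.
  - split=> //; last by case.
    by move=> u _ y; rewrite (z0 y) linear0.
have [|W [R [q [s [c [[[res aW R0 Rlow] [hs hstop]] [cc cmin cgen]]]]]]] :=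
  IHn (fun i => cs (lift ord0 i)); first by move=> i; exact: cocs.
pose c0 := cs ord0.
have [dep|indep] := pselect (exists (u : {linear R d.+1 -> P})
    (a : {linear F d -> P}), forall x, c0 x = u (c x) + a (pF d x)).
  exists W, R, q, s, c; do 2![split=> //].
  by move=> i; have [j ->|->] := unliftP ord0 i.
have [t [t' [tt' t't]]] := iso_inverse tau_term_top.
pose c' := pairing (t' \o c0) c.
exists (dsum tau W), (fun m => dsum (rev_obj E d.+1 m) (R m)), (dmap p q),
  (fun m => dmap (r m) (s m)), c'.
split; first split; first split.
- exact: projective_resolution_dsum tau_resolution res.
- by apply: in_add_dsum => //; exact/in_add_dsuml/in_add_refl.
- move=> m dm [x y]; congr pair; last exact: R0.
  exact: rev_obj_zero.
- move=> m md; have [[M1 n1] [M2 n2]] := (tau_term_lower md, Rlow m md).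
  by split; [exact: sub_dsum | exact: no_hom_dsum].
- split=> [N m MN md|N N0]; apply: hom_exact_dsum; [exact: tau_hom|exact: hs|
    exact: tau_hom_top|exact: hstop].
- have uE (u : {linear dsum (rev_obj E d.+1 d.+1) (R d.+1) -> P}) x :
      u (c' x) = u (t' (c0 x), 0) + u (0, c x).
    by rewrite -linearD; congr (u _); exact: (dsum_split (c' x)).
  split.
  + by move=> x; rewrite /c' pairingE cc /= /c0 cocs linear0.
  + move=> u [a uca] [y z]; rewrite [(y, z)]dsum_split linearD /=.
    pose v : {linear P -> P} := u \o (in1 _ _ \o t').
    pose u2 : {linear R d.+1 -> P} := u \o in2 _ _.
    have v0 : forall w, v w = 0.
      apply: contrapT => /existsNP[w vw]; apply: indep.
      have [w' [vw' w'v]] :=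
        bij_inverse (simple_inj sP vw) (simple_surj sP vw).
      exists (\- (w' \o u2)), (w' \o a) => x /=.
      rewrite -uca uE -[u (t' _, 0)]/(v (c0 x)) linearD vw' addrC addrK //.
    have u20 : forall z, u2 z = 0.
      apply: cmin; exists a => x.
      by rewrite -uca uE -[u (t' _, 0)]/(v (c0 x)) v0 add0r.
    have -> : u (0, z) = 0 by exact: u20.
    by rewrite addr0 -[y]tt'; exact: v0.
  + move=> i; have [j ->|->] := unliftP ord0 i.
      have [u [a ua]] := cgen j; exists (u \o out2 _ _), a => x.
      by rewrite /= ua.
    by exists (t \o out1 _ _), \0 => x; rewrite /= t't addr0.
Qed.

(** The universal cocycle is realised by a map Y -> W; adding the projective
    module R_0 makes it surjective, and L is its kernel. The mapping cone is
    a resolution of L; since Ext^(d+1)(W, N) -> Ext^(d+1)(Y, N) is bijective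
    for N in M and the Ext groups in degrees 1 to d vanish, Ext^i(L, M) = 0
    for 1 <= i <= d + 1. So L is projective and lies in M, the inclusion of
    L splits, and Y is a summand of L + W. *)
Lemma Y_in_add : in_add Td Y.
Proof.
have [n [cs [ccs span]]] :=
  @hom_span _ _ (F d.+1) P (fun h => forall x, h (pF d.+1 x) = 0).
have [W [R [q [s [c [[[resW aW R0 Rlow] [hs hstop]] [cc cmin cgen]]]]]]] :=
  universal_cocycle ccs.
have [[qS exq exs] pR] := resW; have [[eS exe exp'] pF'] := resF.
have s0 m x : (d <= m)%N -> s m.+1 x = 0.
  by move=> dm; rewrite (R0 m.+2 _ x) ?linear0.
have gen (h : {linear F d.+1 -> P}) : (forall x, h (pF d.+1 x) = 0) ->
    exists (u : {linear R d.+1 -> P}) (a : {linear F d -> P}),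
      forall x, h x = u (c x) + a (pF d x).
  move=> /span[co hE].
  exists (lincomb co (fun i => sval (cid (cgen i)))).
  exists (lincomb co (fun i => sval (cid (svalP (cid (cgen i)))))) => x.
  rewrite hE /= -big_split; apply: eq_bigr => i _ /=.
  by rewrite -kscaleDr; congr kscale; case: cid => u /= cu; case: cid.
have lower_split (N : fgmod A^c) : M N -> exists (N' : fgmod A^c) m
    (a : {linear N -> dsum N' (dsums (nseq m P))})
    (b : {linear dsum N' (dsums (nseq m P)) -> N}),
    [/\ cancel a b, M N' & no_hom N' P].
  have [N' [m [a [b [ab ba N'0]]]]] := simple_decomposition sP pP N.
  move=> MN; exists N', m, a, b; split=> //.
  apply: (@sub_retract _ _ Msub _ _ (b \o in1 _ _) (out1 _ _ \o a)) MN => x /=.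
  by rewrite ba.
(* Ext^(d+1)(W, N) -> Ext^(d+1)(Y, N) is injective. *)
have inj_top (N : fgmod A^c) (b : {linear R d.+1 -> N}) : M N ->
    (exists a : {linear F d -> N}, forall x, b (c x) = a (pF d x)) ->
    exists b' : {linear R d -> N}, forall x, b x = b' (s d x).
  move=> /lower_split[N' [m [u [v [uv MN' N'0]]]]] [a ba].
  have [|b1 b1E] := hstop N' N'0 (out1 _ _ \o (u \o b)).
    by move=> x; rewrite /= s0 // !linear0.
  have [l hl] := in_add_nseq P m.
  have b2 x : (u (b x)).2 = 0.
    rewrite [LHS]hl big1 // => z _.
    have -> : z.1 (u (b x)).2 = 0; last exact: linear0.
    apply: (cmin (z.1 \o (out2 _ _ \o (u \o b)))).
    by exists (z.1 \o (out2 _ _ \o (u \o a))) => y; rewrite /= ba.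
  exists (v \o (in1 _ _ \o b1)) => x /=.
  by rewrite -b1E /= -(b2 x) -surjective_pairing uv.
(* Ext^(d+1)(W, N) -> Ext^(d+1)(Y, N) is surjective. *)
have surj_top (N : fgmod A^c) (a : {linear F d.+1 -> N}) : M N ->
    (forall x, a (pF d.+1 x) = 0) ->
    exists (b : {linear R d.+1 -> N}) (a' : {linear F d -> N}),
      forall x, a x = b (c x) + a' (pF d x).
  move=> /lower_split[N' [m [u [v [uv MN' N'0]]]]] ap.
  have [|a1 a1E] := @extY _ MN' N'0 (out1 _ _ \o (u \o a)).
    by move=> x; rewrite /= ap !linear0.
  have [l hl] := in_add_nseq P m.
  have [b2 [a2 a2E]] : exists (b : {linear R d.+1 -> dsums (nseq m P)})
      (a' : {linear F d -> dsums (nseq m P)}),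
      forall x, (u (a x)).2 = b (c x) + a' (pF d x).
    suff [b [a' E1]] : exists (b : {linear R d.+1 -> dsums (nseq m P)})
      (a' : {linear F d -> dsums (nseq m P)}),
      forall x, \sum_(z <- l) z.2 (z.1 (u (a x)).2) = b (c x) + a' (pF d x).
      by exists b, a' => x; rewrite -E1 -hl.
    elim: l {hl} => [|z l [b [a' E1]]].
      by exists \0, \0 => x; rewrite big_nil addr0.
    have [|b0 [a0 E0]] := gen (z.1 \o (out2 _ _ \o (u \o a))).
      by move=> x; rewrite /= ap !linear0.
    exists ((z.2 \o b0) \+ b), ((z.2 \o a0) \+ a') => x.
    by rewrite big_cons E1 -[z.1 _]/((z.1 \o (out2 _ _ \o (u \o a))) x) E0
      linearD /= addrACA.
  exists (v \o (in2 _ _ \o b2)), (v \o pairing a1 a2) => x /=.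
  rewrite -linearD -[LHS]uv; congr (v _).
  rewrite [LHS]surjective_pairing a2E -a1E /=.
  by congr pair; rewrite /= ?add0r.
(* The terms of R below the top lie in U, where Ext^i(Y, -) = 0
   for 0 < i <= d + 1. *)
have [m md|fY [phi [phid phi0 phiS']]] :=
  @downward_lift _ Y W F eF pF R q s d.+1 c resF resW _ cc.
  have [Mm m0] := Rlow m md; move: md; rewrite ltnS leq_eqVlt.
  by case/orP=> [/eqP e1|]; [subst m; exact: extY | exact: Y_hom].
have phiS m x : s m (phi m.+1 x) = phi m (pF m x).
  have [/phiS'//|dm] := ltnP m d.+1.
  case: m x dm => // m x dm; rewrite s0 //.
  move: dm; rewrite leq_eqVlt => /orP[/eqP [e1]|dm]; last exact/esym/R0.
  by subst m; rewrite phid cc.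
have HZ m (N : fgmod A^c) (b : {linear R m.+1 -> N}) : M N ->
    (forall y, b (s m.+1 y) = 0) ->
    (exists a : {linear F m -> N}, forall x, b (phi m.+1 x) = a (pF m x)) ->
    exists b' : {linear R m -> N}, forall y, b y = b' (s m y).
  move=> MN bs; have [md _|dm|e1] := ltngtP m d.
  - by apply: hs bs.
  - by exists \0 => y; rewrite (R0 m.+1 _ y) ?linear0.
  - by subst m; rewrite phid; exact: inj_top.
pose C m := dsum (F m) (R m.+1).
pose D m : {linear C m.+1 -> C m} := cone_map (pF m) (phi m.+1) (s m.+1).
pose aug : {linear C 0 -> dsum Y (R 0%N)} := cone_map eF (phi 0%N) (s 0%N).
pose sum : {linear dsum Y (R 0%N) -> W} := copair fY q.
have ex_aug : exact_at (D 0) aug by apply: cone_exact => //; exact: phiS.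
have ex_sum : exact_at aug sum.
  apply: exact_sub => [[x y]|[y z]].
    rewrite /aug cone_mapE /sum copairE linearN linearD -phi0.
    by rewrite (exact_comp exq) addr0 addNr.
  rewrite /sum copairE => yz; have [x xE] := eS (- y).
  have /exq[w wE] : q (z - phi 0%N x) = 0.
    by rewrite linearB /= phi0 xE linearN opprK addrC.
  by exists (x, w); rewrite /aug cone_mapE xE opprK wE addrC subrK.
have [L [sL [iL [sS iI sLE]]]] := image_exists aug.
have aug0 x : sL x = 0 <-> aug x = 0.
  split=> [x0|x0]; first by rewrite -sLE x0 linear0.
  by apply: iI; rewrite sLE x0 linear0.
have resL : projective_resolution sL D.
  split=> [|m]; last exact: projective_dsum.
  split=> // [x|m]; last by apply: cone_exact => // x; exact: phiS.
  by rewrite aug0; exact: ex_aug.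
have [|ML pL] := projective_criterion (ltn0Sn d) CT resL.
  move=> N m MN; rewrite ltnS => md; apply: cone_hom => [x|b bs|a ap].
  - exact: phiS.
  - exact: HZ.
  move: md; rewrite leq_eqVlt => /orP[/eqP e1|md].
    subst m; have [b [a' E1]] := surj_top N a MN ap.
    exists b, a'; split=> [y|x]; last by rewrite phid E1.
    by rewrite s0 ?linear0.
  have [a' E1] := Y_hom MN md ap; exists \0, a'; split=> // x.
  by rewrite /= add0r; exact: E1.
(* The same computation one degree lower: the identity of L extends to
   Y + R_0. *)
have [x|b bs|a ap|u|t tE] := @cone_hom _ _ _ _ _ _ _ (pF 0) eF (s 1) (s 0)
  (phi 1) (phi 0) _ L _ _ sL.
- exact: phiS.
- exact: HZ.
- have [|a' E1] := factor_surj (h := a) eS; first by move=> x /exe[z <-].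
  by exists \0, a'; split=> // x; rewrite /= add0r E1.
- by apply/aug0; exact: (exact_comp ex_aug u).
have ti : cancel iL t.
  by move=> l; have [x <-] := sS l; rewrite sLE tE.
have si l : sum (iL l) = 0.
  by have [x <-] := sS l; rewrite sLE (exact_comp ex_sum).
have aL : in_add Td L.
  apply/in_add_dsumr/(in_add_complement isoA) => //.
  apply: no_hom_addl (in_add_retract ti (in_add_refl _)) _.
  by apply: no_hom_dsum => //; have [] := Rlow 0 isT.
have [w [ww' w'w]] : exists w : {linear dsum L W -> dsum Y (R 0%N)},
    cancel (pairing t sum) w /\ cancel w (pairing t sum).
  apply: bij_inverse.
    apply: linear_inj0 => z; rewrite pairingE => -[tz /ex_sum[x xE]].
    by move: tz; rewrite -xE -tE -sLE => ->; rewrite linear0.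
  move=> [l x]; have [y yE] := qS x.
  exists ((0, y) + iL (l - t (0, y))).
  rewrite pairingE; congr pair; first by rewrite linearD ti addrC subrK.
  by rewrite linearD si addr0 /sum copairE linear0 add0r.
apply: (in_add_retract (s := in1 Y (R 0%N)) (r := out1 _ _)) => //.
exact: in_add_retract ww' (in_add_dsum aL aW).
Qed.

End Generator.

Lemma Td_generator (U : fgmod A^c -> Prop) :
  (forall X, U X <-> M X /\ no_hom X P) -> ext_projective_generator d.+1 U Td.
Proof.
move=> UE; split.
  split; first by apply/UE; split; [exact: ct_Td | exact: no_hom_Td].
  by move=> Y /UE[_ Y0]; exact: ext_Td.
move=> Y [/UE[MY Y0] extY]; apply: in_add_of.
have [F [eF [pF [resF pF' _]]]] := extY Y ((UE Y).2 (conj MY Y0)).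
apply: (@Y_in_add Y MY Y0 F eF pF) => // N MN N0.
by apply: hom_exact_of_ext (conj resF pF') (extY _ _); apply/UE.
Qed.

(** ** The torsion class *)

Lemma torsion_class_no_hom (U : fgmod A^c -> Prop) :
  (forall X, U X <-> M X /\ no_hom X P) -> torsion_class d.+1 M U.
Proof.
move=> UE; have [Miso M0 Mdsum Msum] := Msub.
split; [split | by move=> X /UE[] |].
- move=> X Y isoXY /UE[MX X0]; apply/UE; split; first exact: Miso MX.
  have [a [b [ab ba]]] := iso_inverse isoXY.
  exact: no_hom_addl (in_add_retract ba (in_add_refl _)) X0.
- by apply/UE; split=> // h x; rewrite (zero_is_zero x) linear0.
- move=> X Y /UE[MX X0] /UE[MY Y0]; apply/UE.
  by split; [exact: Mdsum | exact: no_hom_dsum].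
- move=> X Y /UE[/Msum[MX MY] XY0]; split; apply/UE; split=> //.
    exact: no_hom_addl (in_add_dsuml Y (in_add_refl X)) XY0.
  exact: no_hom_addl (in_add_dsumr X (in_add_refl Y)) XY0.
move=> X MX; have [X' [m [a [b [ab ba X'0]]]]] := simple_decomposition sP pP X.
pose V n := if n is 0 then dsums (nseq m P) else zero_mod A^c.
have V0 n : (0 < n)%N -> is_zero (V n).
  by case: n => // n _; exact: zero_is_zero.
pose pX : {linear X -> V 0} := out2 _ _ \o a.
pose u : {linear X' -> X} := b \o in1 _ _.
exists X', V, u, pX, (fun=> \0); split.
- apply/UE; split=> //.
  apply: (sub_retract Msub (s := u) (r := out1 _ _ \o a)) MX => x.
  by rewrite /= ba.
- case=> [_|n _]; first exact: (sub_in_add Msub MP (in_add_nseq P m)).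
  exact/(sub_zero Msub)/V0.
- by case=> // n _; exact: V0.
- split.
  + by apply: (can_inj (g := out1 _ _ \o a)) => x; rewrite /= ba.
  + apply: exact_sub => [x|y /= y0]; first by rewrite /= ba.
    by exists (a y).1; rewrite /= -y0 -surjective_pairing ab.
  + by move=> y; split=> // _; exists (b (0, y)); rewrite /= ba.
  + by move=> i y; split=> // _; exists 0; exact/esym/V0.
- move=> W /UE[_ W0]; split=> [h _ w|i h _].
    exact: (no_hom_addr (in_add_nseq P m) W0).
  by exists \0 => w; exact: V0.
Qed.

(** ** The indecomposability of tau *)

Lemma top_no_hom_lower n
    (h : {linear rev_obj E d.+1 n -> rev_obj E d.+1 d.+1}) x :
  (n <= d)%N -> h x = 0.
Proof.
move=> nd; have [u [v [uv vu]]] := iso_inverse tau_term_top.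
have [_ n0] := tau_term_lower nd.
by rewrite -[h x]uv; have /= -> := n0 (u \o h) x; rewrite linear0.
Qed.

Lemma tau_not_projective : ~ projective tau.
Proof.
move=> ptau; have [u [v [uv vu]]] := iso_inverse tau_term_top.
have [|h hE] := hom_exact_of_ext tau_resolution
  (ext_zero_projective d (rev_obj E d.+1 d.+1) ptau) (h := idfun).
  by move=> x; rewrite /= [x](@rev_obj_zero _ E d.+1 d.+2) // linear0.
have [x x0] := simple_nonzero sP.
by apply: x0; rewrite -(vu x) [v x](hE) top_no_hom_lower ?linear0.
Qed.

(** The projection onto X factors through R_0, so X is a projective summand of
    tau, and the minimality of the coresolution leaves no room for it. *)
Lemma tau_summand_zero (X : fgmod A^c) (s : {linear X -> tau})
    (t : {linear tau -> X})
    (eps : forall n, {linear rev_obj E d.+1 n -> rev_obj E d.+1 n}) :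
  cancel s t -> (forall x, p (eps 0%N x) = s (t (p x))) ->
  (forall n x, r n (eps n.+1 x) = eps n (r n x)) ->
  (forall x, eps d.+1 x = 0) -> is_zero X.
Proof.
move=> st eps0 epsS epsd.
have [|z zE] := downward_null (pi := s \o t) tau_resolution eps0 epsS epsd.
  move=> n nd; apply: tau_hom => //.
  by have [] := tau_term_lower nd.
apply: (@cokernel_no_projective_summand _ _ _ _ _ _ min d tau X p s t) => //.
apply: (@projective_retract _ X (E d.+1) (z \o s) (t \o p)) => [x|].
  by have /= <- := zE (s x); rewrite !st.
exact: nu_projective.
Qed.

(** Lift the idempotent of a decomposition to the resolution. In the top
    degree it acts on P, whose endomorphism ring is a division ring; since
    there are no homotopies there, it remains idempotent, so it or its
    complement vanishes. *)
Lemma tau_indecomposable : indecomposable tau.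
Proof.
split=> [tau0|X Z isoXZ]; first exact/tau_not_projective/projective_zero.
have [a [b [ab ba]]] := iso_inverse isoXZ.
have res := tau_resolution.
pose s1 : {linear X -> tau} := b \o in1 X Z.
pose t1 : {linear tau -> X} := out1 X Z \o a.
pose s2 : {linear Z -> tau} := b \o in2 X Z.
pose t2 : {linear tau -> Z} := out2 X Z \o a.
have st1 : cancel s1 t1 by move=> x; rewrite /= ba.
have st2 : cancel s2 t2 by move=> x; rewrite /= ba.
have st12 y : s1 (t1 y) + s2 (t2 y) = y.
  rewrite -[RHS]ab [in RHS](dsum_split (a y)) linearD //.
have [eps [eps0 epsS]] := chain_lift (s1 \o t1) res res.
pose eps' n : {linear rev_obj E d.+1 n -> rev_obj E d.+1 n} := idfun \- eps n.
have eps0' x : p (eps' 0%N x) = s2 (t2 (p x)).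
  by rewrite /= linearB /= eps0 -{1}(st12 (p x)) /= addrC addKr.
have epsS' n x : r n (eps' n.+1 x) = eps' n (r n x).
  by rewrite [eps' n.+1 x]/= linearB epsS.
have [e0|/existsNP[x ex]] := pselect (forall x, eps d.+1 x = 0).
  by left; apply: (tau_summand_zero st1 _ epsS e0) => x; rewrite eps0.
have [e0|/existsNP[y ey]] := pselect (forall x, eps' d.+1 x = 0).
  by right; exact: (tau_summand_zero st2 eps0' epsS' e0).
have [u [v [uv vu]]] := iso_inverse tau_term_top.
have endo_inj (h : {linear rev_obj E d.+1 d.+1 -> rev_obj E d.+1 d.+1}) z :
    h z <> 0 -> forall w, h w = 0 -> w = 0.
  move=> hz w hw; have vI : injective (u \o (h \o v)).
    apply: (simple_inj (h := u \o (h \o v)) (x := u z)) => // /= h0.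
    by apply: hz; rewrite -(uv (h z)) -[z in h z]uv h0 linear0.
  by rewrite -(uv w); have -> : u w = 0;
    [apply: vI; rewrite /= uv hw !linear0 | rewrite linear0].
pose chi n : {linear rev_obj E d.+1 n -> rev_obj E d.+1 n} := eps' n \o eps n.
have [z|n z|h [h' chiE]] := chain_null (phi := chi) res res _ _ d.
- rewrite [chi 0 z]/= -/(eps' 0%N) -[eps 0%N z - _]/(eps' 0%N (eps 0%N z)).
  by rewrite eps0' eps0 /= ba /= !linear0.
- by rewrite -[chi n.+1 z]/(eps' n.+1 (eps n.+1 z)) epsS' epsS.
(* Both homotopy terms vanish: one starts from R_(d+2) = 0, the other maps a
   module without maps to P into the top term, which is P. *)
have chi0 z : chi d.+1 z = 0.
  rewrite chiE top_no_hom_lower // add0r.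
  by rewrite [h' z](@rev_obj_zero _ E d.+1 d.+2) // linear0.
by case: ex; apply: (endo_inj _ _ ey); exact: chi0.
Qed.

Lemma Td_basic n (F : 'I_n -> fgmod A^c) (i0 : 'I_n) :
  (forall i, indecomposable (F i)) -> (forall i j, iso (F i) (F j) -> i = j) ->
  (forall i, projective (F i)) ->
  iso Q (dsums [seq F j | j <- enum 'I_n & j != i0]) ->
  basic Td.
Proof.
move=> indF injF projF isoQ.
pose G i := if i == i0 then tau else F i.
have G0 : G i0 = tau by rewrite /G eqxx.
have GF i : i != i0 -> G i = F i by rewrite /G => /negbTE->.
exists n, G; split=> [|i|i j].
- apply: iso_sym.
  apply: iso_trans (dsums_remove (i := i0) G (enum_uniq _) _) _.
    by rewrite mem_enum.
  rewrite G0; apply: iso_dsum; first exact: iso_refl.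
  suff -> : [seq G j | j <- enum 'I_n & j != i0] =
            [seq F j | j <- enum 'I_n & j != i0] by exact: iso_sym.
  by apply/eq_in_map => j; rewrite mem_filter => /andP[/GF].
- by have [->|/GF->] := eqVneq i i0; [rewrite G0; exact: tau_indecomposable|].
- have no i' : ~ iso tau (F i').
    move=> /iso_inverse[a [b [ab ba]]]; apply: tau_not_projective.
    exact: projective_retract ab (projF i').
  have [->|ii] := eqVneq i i0; have [->|ji] := eqVneq j i0 => //.
  + by rewrite G0 GF // => /no.
  + by rewrite G0 GF // => /iso_sym/no.
  + by rewrite !GF //; exact: injF.
Qed.

(** ** Tilting *)

Lemma Td_resolution : exists (F : nat -> fgmod A^c)
    (eF : {linear F 0%N -> Td}) (pF : forall i, {linear F i.+1 -> F i}),
  projective_resolution eF pF /\ forall n, (d.+1 < n)%N -> is_zero (F n).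
Proof.
have [F [eF [pF [res F0]]]] := trivial_resolution Q_projective.
exists (fun n => dsum (rev_obj E d.+1 n) (F n)), (dmap p eF),
  (fun n => dmap (r n) (pF n)).
split=> [|n dn [x y]].
  exact: (projective_resolution_dsum tau_resolution res).
by congr pair; [exact: rev_obj_zero | apply: F0; case: n dn {x y}].
Qed.

Lemma Td_rigid n : (0 < n)%N -> ext_zero n Td Td.
Proof.
case: n => // n _; have [nd|dn|->] := ltngtP n d.
- exact: ct_ext ct_Td ct_Td nd.
- have [F [eF [pF [res F0]]]] := Td_resolution.
  by apply: ext_of_hom_exact res (hom_exact_zero _); exact: F0.
- exact: ext_Td no_hom_Td.
Qed.

(** The middle terms of 0 -> P -> nu^- I_1 -> ... -> nu^- I_(d+1) -> tau ->
    0 are in add Q, and the identity of Q completes it to a coresolution of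
    A. *)
Lemma Td_coresolution : exists (S : nat -> fgmod A^c)
    (u : {linear regular_mod A^c -> S 0%N})
    (v : forall i, {linear S i -> S i.+1}),
  [/\ coresolution u v, forall i, (i <= d.+1)%N -> in_add Td (S i)
    & forall i, (d.+1 < i)%N -> is_zero (S i)].
Proof.
have [a [b [ab ba]]] := iso_inverse isoA.
have [t [t' [tt' t't]]] := iso_inverse (nu_obj0_iso sP pP min).
pose G i := E i.+1; pose S1 := trunc_obj G tau d.+1.
pose w : forall n, {linear S1 n -> S1 n.+1} :=
  trunc_map (fun i => g i.+1) (T := tau) (d := d) p.
have exw : forall n, exact_at (trunc_map g (T := tau) (d := d.+1) p n)
    (trunc_map g (T := tau) (d := d.+1) p n.+1).
  apply: trunc_exact => // j jd; apply: nu_diff_exact.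
  by apply: ct_ext ct_DA MP _.
pose S2 n := if n is 0 then Q else zero_mod A^c.
have S20 n : (0 < n)%N -> is_zero (S2 n).
  by case: n => // n _; exact: zero_is_zero.
pose u1 : {linear P -> S1 0%N} := g 0%N \o t'.
have ex1 : exact_at u1 (w 0%N).
  apply: exact_sub => [x|y /(exw 0)[x <-]].
    exact: (exact_comp (exw 0)).
  by exists (t x); rewrite /= tt'.
exists (fun n => dsum (S1 n) (S2 n)), (dmap u1 idfun \o a),
  (fun n => dmap (w n) \0); split.
- split.
  + apply: linear_inj0 => x ux; have a2 : (a x).2 = 0 by exact: (congr1 snd ux).
    have ux1 : nu_diff min 0 (t' (a x).1) = 0 by exact: (congr1 fst ux).
    have a1 : (a x).1 = 0.
      rewrite -(t't (a x).1) (_ : t' _ = 0) ?linear0 //.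
      by apply: (nu_diff0_inj sP pP niP (min := min)); rewrite ux1 linear0.
    by rewrite -(ab x) [a x]surjective_pairing a1 a2 linear0.
  + apply: exact_sub => [x|[y z]].
      by rewrite /= (exact_comp ex1).
    rewrite dmapE => /(congr1 fst)/ex1[x xE]; exists (b (x, z)).
    rewrite -[LHS]/(dmap u1 idfun (a (b (x, z)))) ba dmapE.
    by congr pair.
  + move=> n; apply: exact_dmap; first exact: (exw n.+1).
    by move=> y; split=> // _; exists 0; exact/esym/S20.
- move=> n nd; apply: in_add_dsum; last first.
    by case: n {nd} => [|n]; [exact/in_add_dsumr/in_add_refl |
      apply: in_add_zero; exact: S20].
  apply: (@trunc_obj_all _ (fun X => in_add Td X)) => // [j|].
    exact/in_add_dsumr/nu_obj_in_add.
  exact/in_add_dsuml/in_add_refl.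
- move=> n nd [x y]; congr pair; first exact: (trunc_obj_zero nd).
  by apply: S20; case: n nd {x y}.
Qed.

Lemma Td_tilting : tilting d.+1 Td.
Proof.
split; last 1 first.
- have [S [u [v [cores aS S0]]]] := Td_coresolution.
  by exists S, u, v; split=> // i /aS; exact: in_add_of.
- have [F [eF [pF [[res pF'] F0]]]] := Td_resolution.
  by exists F, eF, pF.
- exact: Td_rigid.
Qed.

End WeakAPR.

Theorem theorem6p9 (k : fieldType) (A : falgType k) (d : nat)
    (M : fgmod A^c -> Prop) (P Q tau1P taudP : fgmod A^c) :
  (1 <= d)%N ->
  basic (regular_mod A^c) ->
  cluster_tilting d M ->
  simple_mod P -> projective P -> ~ injective_mod P ->
  iso (regular_mod A^c) (dsum P Q) ->
  is_tau_inv 1 P tau1P ->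
  is_tau_inv d P taudP ->
  let T1 := dsum tau1P Q in
  let Td := dsum taudP Q in
  let U := fun X => Fac T1 X /\ M X in
  [/\ torsion_class d M U,
      ext_projective_generator d U Td,
      basic Td
    & tilting d Td].
Proof.
case: d => // d _ basicA CT sP pP niP isoA [I1 [e1 [f1 [min1 [p1 [p1S ex1]]]]]].
move=> [I [e [f [min [p [pS exp]]]]]] T1 Td U.
have [n [F [i0 [[indF injF projF _ isoQ] QP]]]] :=
  simple_basic_complement basicA sP pP isoA.
have UE X : U X <-> M X /\ no_hom X P.
  split=> [[FX MX]|[MX X0]]; split=> //.
    apply: no_hom_Fac FX _; apply: no_hom_dsum => //.
    exact: (@no_hom_cokernel _ _ _ sP pP _ _ _ min1 0 tau1P p1 p1S).
  apply: Fac_in_add (in_add_dsumr tau1P (in_add_refl Q)) _.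
  exact: Fac_of_no_hom isoA _ _ _ min _ X0.
split.
- exact: torsion_class_no_hom CT sP pP _ UE.
- exact: (@Td_generator _ _ d M P Q taudP CT sP pP niP isoA QP I e f min p).
- exact: (@Td_basic _ _ d M P Q taudP CT sP pP niP I e f min p pS exp n F i0).
- exact: (@Td_tilting _ _ d M P Q taudP CT sP pP niP isoA QP I e f min p).
Qed.
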